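(* Let $A$ be a finite-dimensional $\mathbb{Z}$-graded algebra over a field $K$ with a triangular decomposition $(A^-,T,A^+)$. The morphism $$\chi:\mathrm{K}_0(\mathcal{G}(A))\to\mathrm{K}_0(\mathcal{G}(T))$$ induced by viewing a graded $A$-module as a graded $T$-module is injective.
   Context: A triangular decomposition of $A$ is a triple $(A^-,T,A^+)$ of graded subalgebras such that: (a) multiplication $A^-\otimes_K T\otimes_K A^+\to A$ is an isomorphism of vector spaces; (b) $T$ is concentrated in degree $0$, $A^+$ is supported in degrees $\ge 0$ and $A^-$ in degrees $\le 0$; (c) $A^-_0=K=A^+_0$; (d) $A^+T=TA^+$ and $A^-T=TA^-$; (e) $T$ is split over $K$, i.e. $\operatorname{End}_T(\lambda)=K$ for every simple $T$-module $\lambda$. $\mathcal{G}(A)$ (resp. $\mathcal{G}(T)$) is the category of finitely generated graded left modules with degree-preserving morphisms, and $\mathrm{K}_0$ its Grothendieck group as an abelian category (the free abelian group on isomorphism classes of simple objects). $\mathrm{K}_0$ is a $\mathbb{Z}[t,t^{-1}]$-module with $t$ acting by the degree shift $[1]$, $M[1]_i=M_{i-1}$, and $\chi$ is $\mathbb{Z}[t,t^{-1}]$-linear. *)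

(* Defs.v *)
From HB Require Import structures.
From mathcomp Require Import all_boot all_order all_algebra all_field.
From mathcomp Require Import boolp.

Set Implicit Arguments.
Unset Strict Implicit.
Unset Printing Implicit Defensive.

Import GRing.Theory.
Local Open Scope ring_scope.

(* V is the internal direct sum of the additive subgroups V_ i.  The sums range
   over finite sequences of degrees. *)
Record is_grading (V : zmodType) (V_ : int -> V -> Prop) : Prop := IsGrading {
  grading0 : forall i, V_ i 0;
  gradingB : forall i u v, V_ i u -> V_ i v -> V_ i (u - v);
  grading_span : forall v, exists (s : seq int) (f : int -> V),
    (forall i, V_ i (f i)) /\ v = \sum_(i <- s) f i;
  grading_free : forall (s : seq int) (f : int -> V),
    uniq s -> (forall i, V_ i (f i)) -> \sum_(i <- s) f i = 0 ->
    forall i, i \in s -> f i = 0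
}.

Definition finitely_generated (R : pzRingType) (M : lmodType R) : Prop :=
  exists (n : nat) (e : 'I_n -> M),
    forall m, exists c : 'I_n -> R, m = \sum_i c i *: e i.

Definition simple_module (R : pzRingType) (M : lmodType R) : Prop :=
  (exists m : M, m <> 0) /\
  forall N : M -> Prop,
    N 0 -> (forall x y, N x -> N y -> N (x + y)) ->
    (forall a x, N x -> N (a *: x)) ->
    (forall x, N x -> x = 0) \/ (forall x, N x).

Definition split_algebra (K : fieldType) (T : falgType K) : Prop :=
  forall S : lmodType T, simple_module S ->
    forall f : {linear S -> S}, exists c : K, forall x, f x = c%:A *: x.

Section GradedModules.
Variables (R : pzRingType) (R_ : int -> R -> Prop).

Record gmod := GMod {
  gmod_sort :> lmodType R;
  gmod_deg : int -> gmod_sort -> Prop;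
  gmod_grading : is_grading gmod_deg;
  gmod_act : forall i j a m,
    R_ i a -> gmod_deg j m -> gmod_deg (i + j) (a *: m);
  gmod_fg : finitely_generated gmod_sort
}.

Definition degree_preserving (M N : gmod) (f : M -> N) : Prop :=
  forall i m, gmod_deg i m -> gmod_deg i (f m).

(* 0 -> L -> M -> N -> 0 *)
Record short_exact (L M N : gmod) (f : {linear L -> M}) (g : {linear M -> N}) :
    Prop := ShortExact {
  ses_degl : degree_preserving f;
  ses_degr : degree_preserving g;
  ses_inj : injective f;
  ses_mid : forall m, g m = 0 <-> exists l, m = f l;
  ses_surj : forall n, exists m, n = g m
}.

(* K0 is the abelian group presented by one generator [M] for each object M and
   the relations [M] = [L] + [N] for each short exact sequence 0->L->M->N->0.
   A word is a formal sum of signed generators, (true, M) standing for [M] and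
   (false, M) for -[M].  K0 cannot be a zmodType: objects have carriers in an
   arbitrary lmodType, so that K0 lives in too large a universe. *)
Definition word := seq (bool * gmod).

Inductive k0_eq : word -> word -> Prop :=
| k0_refl x : k0_eq x x
| k0_sym x y : k0_eq x y -> k0_eq y x
| k0_trans x y z : k0_eq x y -> k0_eq y z -> k0_eq x z
| k0_cat x x' y y' : k0_eq x x' -> k0_eq y y' -> k0_eq (x ++ y) (x' ++ y')
| k0_comm x y : k0_eq (x ++ y) (y ++ x)
| k0_inv M : k0_eq [:: (true, M); (false, M)] [::]
| k0_ses L M N f g : @short_exact L M N f g ->
    k0_eq [:: (true, M)] [:: (true, L); (true, N)].

Definition K0 := {P : word -> Prop | exists w, P = k0_eq w}.

Definition k0_of (w : word) : K0 :=
  exist _ (k0_eq w) (ex_intro (fun v => k0_eq w = k0_eq v) w erefl).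
Definition k0_repr (x : K0) : word := projT1 (cid (proj2_sig x)).

Definition k0_class (M : gmod) : K0 := k0_of [:: (true, M)].

Lemma k0_reprK x : k0_of (k0_repr x) = x.
Proof.
case: x => P HP; rewrite /k0_of /k0_repr /=; case: cid => w /= eP.
by subst P; congr exist; exact: Prop_irrelevance.
Qed.

Lemma k0_ofP w v : k0_of w = k0_of v <-> k0_eq w v.
Proof.
split=> [[e]|wv]; first by rewrite e; exact: k0_refl.
suff e : k0_eq w = k0_eq v.
  rewrite /k0_of; move: (ex_intro _ _ _); rewrite e => p.
  by congr exist; exact: Prop_irrelevance.
apply: funext => u; apply: propext; split; last exact: k0_trans.
by apply: k0_trans; exact: k0_sym.
Qed.

Lemma k0_repr_of w : k0_eq (k0_repr (k0_of w)) w.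
Proof. by apply/k0_ofP; rewrite k0_reprK. Qed.

Definition flip (w : word) : word := [seq (~~ p.1, p.2) | p <- w].

Lemma k0_eq_flip w : k0_eq (w ++ flip w) [::].
Proof.
elim: w => [|[b M] w IH]; first exact: k0_refl.
apply: (@k0_trans _ ([:: (b, M); (~~ b, M)] ++ (w ++ flip w))); last first.
  rewrite -[X in k0_eq _ X](cats0 [::]); apply: k0_cat IH; case: b.
    exact: k0_inv.
  by apply: k0_trans (k0_inv M); exact: (k0_comm [:: _] [:: _]).
apply: (@k0_cat [:: (b, M)] [:: (b, M)]); first exact: k0_refl.
have := k0_cat (k0_comm w [:: (~~ b, M)]) (k0_refl (flip w)).
by rewrite -catA.
Qed.

Lemma k0_flip_compat x y : k0_eq x y -> k0_eq (flip x) (flip y).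
Proof.
move=> xy; apply: (@k0_trans _ (flip x ++ (y ++ flip y))).
  rewrite -[X in k0_eq X _]cats0; apply: k0_cat (k0_refl _) _.
  exact/k0_sym/k0_eq_flip.
rewrite catA -[X in k0_eq _ X]cat0s; apply: k0_cat (k0_refl _).
apply: k0_trans (k0_eq_flip x); apply: k0_trans (k0_comm _ _) _.
exact: k0_cat (k0_sym xy) (k0_refl _).
Qed.

Definition k0_zero : K0 := k0_of [::].
Definition k0_add (x y : K0) : K0 := k0_of (k0_repr x ++ k0_repr y).
Definition k0_opp (x : K0) : K0 := k0_of (flip (k0_repr x)).

Lemma k0_addE w v : k0_add (k0_of w) (k0_of v) = k0_of (w ++ v).
Proof. by apply/k0_ofP; apply: k0_cat; exact: k0_repr_of. Qed.

Lemma k0_addA : associative k0_add.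
Proof.
move=> x y z; rewrite -(k0_reprK x) -(k0_reprK y) -(k0_reprK z).
by rewrite !k0_addE catA.
Qed.

Lemma k0_addC : commutative k0_add.
Proof. by move=> x y; apply/k0_ofP; exact: k0_comm. Qed.

Lemma k0_add0 : left_id k0_zero k0_add.
Proof. by move=> x; rewrite -(k0_reprK x) k0_addE. Qed.

Lemma k0_addN : left_inverse k0_zero k0_opp k0_add.
Proof.
move=> x; rewrite k0_addC -{1}(k0_reprK x) k0_addE.
exact/k0_ofP/k0_eq_flip.
Qed.

Lemma k0_class_ses L M N f g : @short_exact L M N f g ->
  k0_class M = k0_add (k0_class L) (k0_class N).
Proof. by move=> fg; rewrite k0_addE; apply/k0_ofP; exact: k0_ses fg. Qed.

(* The degree shift M[d], M[d]_i = M_(i - d), and the action of t ^ d on K0 that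
   it induces. *)
Lemma shift_grading (d : int) (M : gmod) :
  is_grading (fun i => @gmod_deg M (i - d)).
Proof.
case: (gmod_grading M) => g0 gB gs gf; split.
- by move=> i; exact: g0.
- by move=> i; exact: gB.
- move=> v; have [s [f [fP ->]]] := gs v.
  exists [seq i + d | i <- s], (fun i => f (i - d)); split=> [i|]; first exact: fP.
  by rewrite big_map; apply: eq_bigr => i _; rewrite addrK.
- move=> s f us fP f0 i si.
  rewrite -(subrK d i); apply: (gf [seq i - d | i <- s] (fun i => f (i + d))).
  + by rewrite map_inj_uniq //; exact: addIr.
  + by move=> j; have := fP (j + d); rewrite addrK.
  + by rewrite big_map -[RHS]f0; apply: eq_bigr => j _; rewrite subrK.
  + exact: map_f.
Qed.

Lemma shift_act (d : int) (M : gmod) i j (a : R) (m : M) :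
  R_ i a -> gmod_deg (j - d) m -> gmod_deg (i + j - d) (a *: m).
Proof. by rewrite -addrA; exact: gmod_act. Qed.

Definition shift (d : int) (M : gmod) : gmod :=
  @GMod M _ (shift_grading d M) (@shift_act d M) (gmod_fg M).

Definition shift_word (d : int) (w : word) : word :=
  [seq (p.1, shift d p.2) | p <- w].

Lemma shift_k0_eq d x y : k0_eq x y -> k0_eq (shift_word d x) (shift_word d y).
Proof.
elim=> {x y}.
- by move=> x; exact: k0_refl.
- by move=> x y _; exact: k0_sym.
- by move=> x y z _ xy _; exact: k0_trans.
- by move=> x x' y y' _ xx' _ yy'; rewrite /shift_word !map_cat; exact: k0_cat.
- by move=> x y; rewrite /shift_word !map_cat; exact: k0_comm.
- by move=> M; exact: k0_inv.
- move=> L M N f g [fd gd fi fg gs].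
  apply: (@k0_ses (shift d L) (shift d M) (shift d N) f g).
  by split=> // i m; [exact: fd | exact: gd].
Qed.

Definition k0_shift (d : int) (x : K0) : K0 := k0_of (shift_word d (k0_repr x)).

Lemma k0_shift_of d w : k0_shift d (k0_of w) = k0_of (shift_word d w).
Proof. by apply/k0_ofP/shift_k0_eq/k0_repr_of. Qed.

End GradedModules.

Section Tensor.
Variables (K : fieldType) (U V W : vectType K).

(* A concrete model of the tensor product of U and V: the matrix t stands for
   the sum of the t i j *: (e_i (x) f_j), where e and f are the bases
   vbasis {:U} and vbasis {:V}. *)
Definition tensor : vectType K := 'M[K]_(\dim {:U}, \dim {:V}).

Definition pure_tensor (u : U) (v : V) : tensor :=
  \matrix_(i, j) (coord (vbasis {:U}) i u * coord (vbasis {:V}) j v).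

Definition tensor_lift (b : U -> V -> W) (t : tensor) : W :=
  \sum_i \sum_j (t : 'M_(_, _)) i j *: b (vbasis {:U})`_i (vbasis {:V})`_j.

Lemma tensor_lift_linear b : linear (tensor_lift b).
Proof.
move=> k s t; rewrite /tensor_lift scaler_sumr -big_split; apply: eq_bigr => i _ /=.
rewrite scaler_sumr -big_split; apply: eq_bigr => j _ /=.
by rewrite !mxE scalerDl scalerA.
Qed.

Lemma tensor_lift_pure b u v :
  (forall v, linear (b^~ v)) -> (forall u, linear (b u)) ->
  tensor_lift b (pure_tensor u v) = b u v.
Proof.
move=> bl br.
pose fl w := HB.pack_for {linear U -> W} (b^~ w)
  (GRing.isLinear.Build K U W _ _ (bl w)).
pose fr w := HB.pack_for {linear V -> W} (b w)
  (GRing.isLinear.Build K V W _ _ (br w)).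
rewrite [in RHS](coord_vbasis (memvf u)) -[RHS]/(fl v _) linear_sum.
apply: eq_bigr => i _; rewrite linearZ /=.
rewrite [in RHS](coord_vbasis (memvf v)) -[b _ _ in RHS]/(fr _ _) linear_sum.
by rewrite scaler_sumr; apply: eq_bigr => j _; rewrite linearZ /= scalerA mxE.
Qed.

End Tensor.

Section Triangular.
Variables (K : fieldType) (A : falgType K) (A_ : int -> {vspace A}).

Record graded_algebra : Prop := GradedAlgebra {
  galg_grading : is_grading (fun i a => a \in A_ i);
  galg_one : 1 \in A_ 0;
  galg_mul : forall i j, (A_ i * A_ j <= A_ (i + j))%VS
}.

(* {aspace A} does not require U to contain the unit of A. *)
Definition graded_subalgebra (U : {aspace A}) : Prop :=
  1 \in U /\
  forall u, u \in U -> exists (s : seq int) (f : int -> A),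
    (forall i, f i \in (U :&: A_ i)%VS) /\ u = \sum_(i <- s) f i.

Definition triple_mult (Am T Ap : {aspace A}) :
    tensor (tensor (subvs_of Am) (subvs_of T)) (subvs_of Ap) -> A :=
  tensor_lift (fun xy z =>
    tensor_lift (fun x y => vsval x * vsval y : A) xy * vsval z).

Record triangular_decomposition (Am T Ap : {aspace A}) : Prop := Triangular {
  tri_subm : graded_subalgebra Am;
  tri_subT : graded_subalgebra T;
  tri_subp : graded_subalgebra Ap;
  tri_mult : bijective (@triple_mult Am T Ap);
  tri_degT : (T <= A_ 0)%VS;
  tri_degp : forall i : int, (i < 0)%R -> (Ap :&: A_ i = 0)%VS;
  tri_degm : forall i : int, (0 < i)%R -> (Am :&: A_ i = 0)%VS;
  tri_conm : (Am :&: A_ 0 = 1)%VS;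
  tri_conp : (Ap :&: A_ 0 = 1)%VS;
  tri_commp : (Ap * T = T * Ap)%VS;
  tri_commm : (Am * T = T * Am)%VS;
  tri_split : split_algebra (subvs_of T)
}.

Lemma tri_one Am T Ap : triangular_decomposition Am T Ap -> 1 \in T.
Proof. by case=> _ []. Qed.

Section Restriction.
Variables (T : {aspace A}) (T1 : 1 \in T).

Definition alg_deg (i : int) (a : A) : Prop := a \in A_ i.
Definition sub_deg (i : int) (a : subvs_of T) : Prop := vsval a \in A_ i.

Let vsval1 : vsval (1 : subvs_of T) = 1.
Proof. by apply/eqP; rewrite algid_eq1. Qed.

(* The unit proof T1 is an argument of res because it is what makes scaling by
   the unit of subvs_of T the identity. *)
Definition res of 1 \in T := fun M : lmodType A => M : Type.

Section ResModule.
Variable M : lmodType A.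
Local Notation rM := (res T1 M).
HB.instance Definition _ := GRing.Zmodule.copy rM M.

Let scale (a : subvs_of T) (m : rM) : rM := (vsval a *: (m : M)).

Let scaleA a b m : scale a (scale b m) = scale (a * b) m.
Proof. by rewrite /scale scalerA. Qed.
Let scale1 : left_id 1 scale.
Proof. by move=> m; rewrite /scale vsval1 scale1r. Qed.
Let scaleDr : right_distributive scale +%R.
Proof. by move=> a m n; rewrite /scale scalerDr. Qed.
Let scaleDl m : {morph scale^~ m : a b / a + b}.
Proof. by move=> a b; rewrite /scale linearD scalerDl. Qed.

HB.instance Definition _ := GRing.Zmodule_isLmodule.Build (subvs_of T) rM
  scaleA scale1 scaleDr scaleDl.

Lemma res_scaleE (a : subvs_of T) (m : rM) : a *: m = vsval a *: (m : M).
Proof. by []. Qed.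

Lemma res_fg : finitely_generated M -> finitely_generated (rM : lmodType _).
Proof.
case=> n [e eP]; pose I : finType := ('I_n * 'I_(\dim {:A}))%type.
pose b := vbasis {:A}.
pose e' (p : I) : rM := b`_p.2 *: e p.1.
suff H m : exists c : I -> subvs_of T, m = \sum_p c p *: e' p.
  exists #|I|, (fun k => e' (enum_val k)) => m; have [c ->] := H m.
  exists (fun k => c (enum_val k)).
  rewrite (reindex (@enum_val I I)) //=.
  by apply: onW_bij; exact: enum_val_bij.
have [c ->] := eP m; exists (fun p => (coord b p.2 (c p.1))%:A).
rewrite -(pair_bigA _ (fun i j => (coord b j (c i))%:A *: e' (i, j))) /=.
apply: eq_bigr => i _; rewrite {1}(coord_vbasis (memvf (c i))) scaler_suml.
apply: eq_bigr => j _.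
have vsvalA k : vsval (k%:A : subvs_of T) = k%:A.
  by rewrite linearZ; exact: (congr1 ( *:%R k) vsval1).
by rewrite res_scaleE vsvalA scalerA -scalerAl mul1r.
Qed.

End ResModule.

Lemma res_act (M : gmod alg_deg) i j (a : subvs_of T) (m : res T1 M) :
  sub_deg i a -> @gmod_deg _ _ M j m -> @gmod_deg _ _ M (i + j) (a *: m).
Proof. exact: (@gmod_act _ alg_deg M i j (vsval a) m). Qed.

Definition res_gmod (M : gmod alg_deg) : gmod sub_deg :=
  @GMod _ sub_deg (res T1 M) (@gmod_deg _ _ M) (gmod_grading M) (@res_act M)
    (res_fg (gmod_fg M)).

Section ResMap.
Variables (M N : lmodType A) (f : {linear M -> N}).
Definition res_map (m : res T1 M) : res T1 N := f m.
Let res_map_linear : linear res_map.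
Proof. by move=> a m n; rewrite /res_map linearP. Qed.
HB.instance Definition _ :=
  GRing.isLinear.Build _ (res T1 M) (res T1 N) _ res_map res_map_linear.
End ResMap.

Definition res_word (w : word alg_deg) : word sub_deg :=
  [seq (p.1, res_gmod p.2) | p <- w].

Lemma res_k0_eq x y : k0_eq x y -> k0_eq (res_word x) (res_word y).
Proof.
elim=> {x y}.
- by move=> x; exact: k0_refl.
- by move=> x y _; exact: k0_sym.
- by move=> x y z _ xy _; exact: k0_trans.
- by move=> x x' y y' _ xx' _ yy'; rewrite /res_word !map_cat; exact: k0_cat.
- by move=> x y; rewrite /res_word !map_cat; exact: k0_comm.
- by move=> M; exact: k0_inv.
- move=> L M N f g [fd gd fi fg gs].
  apply: (@k0_ses _ _ (res_gmod L) (res_gmod M) (res_gmod N)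
    (res_map f : {linear _ -> _}) (res_map g : {linear _ -> _})).
  by split.
Qed.

Definition chi (x : K0 alg_deg) : K0 sub_deg := k0_of (res_word (k0_repr x)).

Lemma chi_of w : chi (k0_of w) = k0_of (res_word w).
Proof. by apply/k0_ofP/res_k0_eq/k0_repr_of. Qed.

Lemma chi_class M : chi (k0_class M) = k0_class (res_gmod M).
Proof. exact: chi_of. Qed.

Lemma chi_add x y : chi (k0_add x y) = k0_add (chi x) (chi y).
Proof. by rewrite chi_of k0_addE /res_word map_cat. Qed.

Lemma res_shift d M : res_gmod (shift d M) = shift d (res_gmod M).
Proof.
rewrite /shift /res_gmod /=.
by congr (@GMod _ _ _ _ _ _ _); exact: Prop_irrelevance.
Qed.

Lemma chi_shift d x : chi (k0_shift d x) = k0_shift d (chi x).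
Proof.
rewrite chi_of k0_shift_of /res_word /shift_word -!map_comp.
by congr k0_of; apply: eq_map => -[b M] /=; rewrite res_shift.
Qed.

End Restriction.

End Triangular.

Arguments chi {K A} A_ {T} T1 x.

(* Main.v *)
From HB Require Import structures.
From Stdlib Require List.
Require Import Defs.
From mathcomp Require Import all_boot all_order all_algebra all_field.
From mathcomp Require Import boolp generic_quotient ring_quotient.

(** Let L be a simple graded A-module and d its top degree, the largest one with
    L_d nonzero.  Everything rests on how A = A^- T A^+ acts on L_d: the part of
    A^+ in positive degrees kills L_d, the part of A^- in negative degrees leaves
    L_d, and what remains of both is K.  Hence the action of any a on L_d,
    followed by the projection onto L_d, is the action of some t in T
    ([top_act]).  Two facts follow.
    - L_d is a simple T-module ([simple_top]): for a T-submodule P of L_d, the x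
      with all the top components of the elements a x in P form a graded
      A-submodule of L, which contains P and so is 0 or L.
    - L_d and d determine L ([top_iso_k0]): given a T-isomorphism of L_d with
      L'_d, the pairs (x, x') such that the top components of a x and a x'
      correspond for all a form a graded A-submodule of L x L', and simplicity of
      L and L' makes it the graph of an isomorphism.

    So, with simple modules ordered by top degree, the matrix of chi is
    unitriangular: the restriction of L is L_d plus terms in degrees below d.  To
    exploit this, represent an element of the kernel of chi by a signed word of
    simple modules ([word_k0_simple]), and let d be the largest top degree in it,
    attained by L.  The multiplicity of L_d as a factor in degree d is an additive
    function on the Grothendieck group over T ([word_mult_k0]), and it vanishes on
    every entry not isomorphic to L.  It is 0 on the word, so some entry
    isomorphic to L comes with the opposite sign; the two cancel, and induction on
    the number of entries concludes ([simple_word_inj]).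

    The multiplicity of a simple module U is taken to be the largest number of
    steps isomorphic to U in a chain of submodules.  With this definition
    additivity on short exact sequences needs no Jordan-Hoelder theorem: chains in
    the outer terms concatenate ([chain_map]), and a chain in the middle term
    induces one in each outer term, each step isomorphic to U surviving in exactly
    one of them because U is simple ([chain_split]). *)

Set Implicit Arguments.
Unset Strict Implicit.
Unset Printing Implicit Defensive.

Import Order.TTheory GRing.Theory Num.Theory.
Local Open Scope ring_scope.

(** * Submodules, and modules carried by submodules and quotients *)

Section Submodules.
Variable R : pzRingType.

Definition submod (M : lmodType R) (P : M -> Prop) : Prop :=
  P 0 /\ forall a x y, P x -> P y -> P (a *: x + y).

Section Closure.
Variables (M : lmodType R) (P : M -> Prop) (sP : submod P).

Lemma submod0 : P 0. Proof. by case: sP. Qed.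

Lemma submodD x y : P x -> P y -> P (x + y).
Proof. by move=> Px Py; have := sP.2 1 x y Px Py; rewrite scale1r. Qed.

Lemma submodZ a x : P x -> P (a *: x).
Proof. by move=> Px; have := sP.2 a x 0 Px submod0; rewrite addr0. Qed.

Lemma submodN x : P x -> P (- x).
Proof. by move=> Px; rewrite -scaleN1r; exact: submodZ. Qed.

End Closure.

Lemma submod_zero (M : lmodType R) : submod (fun x : M => x = 0).
Proof. by split=> // a x y -> ->; rewrite scaler0 addr0. Qed.

Lemma submod_image (M N : lmodType R) (f : {linear M -> N}) P :
  submod P -> submod (fun y => exists2 x, P x & f x = y).
Proof.
move=> sP; split; first by exists 0; [exact: submod0 | exact: raddf0].
move=> a _ _ [x Px <-] [y Py <-].
by exists (a *: x + y); [exact: sP.2 | exact: linearP].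
Qed.

Lemma submod_preim (M N : lmodType R) (f : {linear M -> N}) P :
  submod P -> submod (fun x => P (f x)).
Proof.
move=> sP; split; first by rewrite raddf0; exact: submod0.
by move=> a x y Px Py; rewrite linearP; exact: sP.2.
Qed.

Lemma submod_and (M : lmodType R) (P Q : M -> Prop) :
  submod P -> submod Q -> submod (fun x => P x /\ Q x).
Proof.
move=> sP sQ; split; first by split; exact: submod0.
by move=> a x y [? ?] [? ?]; split; [exact: sP.2 | exact: sQ.2].
Qed.

Section SubQuotient.
Variables (M : lmodType R) (P : M -> Prop) (sP : submod P).

(** The proof of [submod P] is an argument because the closure instance of the
    predicate is found from it. *)
Definition sub_pred of submod P : {pred M} := fun x => `[< P x >].

Lemma sub_predE x : x \in sub_pred sP <-> P x.
Proof. split; [exact: asboolW | exact: asboolT]. Qed.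

Lemma sub_pred_closed : submod_closed (sub_pred sP).
Proof.
split; first by apply/sub_predE; exact: submod0.
by move=> a x y /sub_predE Px /sub_predE Py; apply/sub_predE; exact: sP.2.
Qed.

HB.instance Definition _ := GRing.isSubmodClosed.Build R M (sub_pred sP)
  sub_pred_closed.

Record sub_mod := SubMod { sub_val : M; _ : sub_val \in sub_pred sP }.
HB.instance Definition _ := [isSub for sub_val].
HB.instance Definition _ := [Choice of sub_mod by <:].
HB.instance Definition _ := [SubChoice_isSubLmodule of sub_mod by <:].

Definition sub_incl : {linear sub_mod -> M} := val.

Lemma sub_incl_inj : injective sub_incl.
Proof. exact: val_inj. Qed.

Lemma sub_inclP x : P (sub_incl x).
Proof. by case: x => x /= /sub_predE. Qed.

Lemma sub_incl_surj x : P x -> exists y, sub_incl y = x.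
Proof. by move=> /sub_predE Px; exists (SubMod Px). Qed.

Definition quo_mod := Quotient.quot (sub_pred sP : zmodClosed M).
HB.instance Definition _ := GRing.Zmodule.on quo_mod.

Definition quo_pi (x : M) : quo_mod :=
  (\pi_(Quotient.quot (sub_pred sP : zmodClosed M)) x)%qT.

Lemma quo_pi_surj q : exists x, quo_pi x = q.
Proof. by exists (repr q); exact: reprK. Qed.

Lemma quo_pi_eq x y : quo_pi x = quo_pi y <-> P (x - y).
Proof.
rewrite -sub_predE Quotient.idealrBE; split=> [e|/eqP //]; exact/eqP.
Qed.

Lemma quo_piB : zmod_morphism quo_pi.
Proof. exact: pi_is_zmod_morphism. Qed.
HB.instance Definition _ := GRing.isZmodMorphism.Build M quo_mod quo_pi quo_piB.

Definition quo_scale a (q : quo_mod) : quo_mod := quo_pi (a *: repr q).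

Lemma quo_scaleE a x : quo_scale a (quo_pi x) = quo_pi (a *: x).
Proof.
apply/quo_pi_eq; rewrite -scalerBr; apply: submodZ => //.
by apply/quo_pi_eq; exact: reprK.
Qed.

Lemma quo_scaleA a b q : quo_scale a (quo_scale b q) = quo_scale (a * b) q.
Proof. by have [x <-] := quo_pi_surj q; rewrite !quo_scaleE scalerA. Qed.
Lemma quo_scale1 : left_id 1 quo_scale.
Proof. by move=> q; have [x <-] := quo_pi_surj q; rewrite quo_scaleE scale1r. Qed.
Lemma quo_scaleDr : right_distributive quo_scale +%R.
Proof.
move=> a p q; have [[x <-] [y <-]] := (quo_pi_surj p, quo_pi_surj q).
by rewrite -raddfD !quo_scaleE scalerDr raddfD.
Qed.
Lemma quo_scaleDl q : {morph quo_scale^~ q : a b / a + b}.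
Proof.
by move=> a b; have [x <-] := quo_pi_surj q; rewrite !quo_scaleE scalerDl raddfD.
Qed.
HB.instance Definition _ := GRing.Zmodule_isLmodule.Build R quo_mod
  quo_scaleA quo_scale1 quo_scaleDr quo_scaleDl.

Lemma quo_piZ : scalable quo_pi.
Proof. by move=> a x; rewrite -quo_scaleE. Qed.
HB.instance Definition _ := GRing.isScalable.Build R M quo_mod _ quo_pi quo_piZ.

Lemma quo_pi0 x : quo_pi x = 0 <-> P x.
Proof. by rewrite -(raddf0 quo_pi) quo_pi_eq subr0. Qed.

Definition quo_map : {linear M -> quo_mod} := quo_pi.

End SubQuotient.
End Submodules.

(** * Homogeneous components, graded submodules and quotients *)

Lemma big_supp (V : zmodType) (I : eqType) (s S : seq I) (f : I -> V) :
  uniq s -> uniq S -> {subset s <= S} -> (forall i, i \notin s -> f i = 0) ->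
  \sum_(i <- S) f i = \sum_(i <- s) f i.
Proof.
move=> us uS sS f0; rewrite (bigID (mem s)) /= [X in _ + X]big1 // addr0.
rewrite -big_filter; apply: perm_big; apply: uniq_perm => //.
  exact: filter_uniq.
move=> i; rewrite mem_filter; apply/andP/idP => [[]//|si]; split=> //.
exact: sS.
Qed.

Section Components.
Variables (V : zmodType) (V_ : int -> V -> Prop) (gV : is_grading V_).

Lemma gradingN i u : V_ i u -> V_ i (- u).
Proof. by move=> Vu; rewrite -sub0r; apply: (gradingB gV) => //; exact: grading0. Qed.

Lemma gradingD i u v : V_ i u -> V_ i v -> V_ i (u + v).
Proof.
by move=> Vu Vv; rewrite -[v]opprK; apply: (gradingB gV) => //; exact: gradingN.
Qed.

Definition decomposes (v : V) (f : int -> V) : Prop :=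
  (forall i, V_ i (f i)) /\
  exists s, [/\ uniq s, forall i, i \notin s -> f i = 0 & v = \sum_(i <- s) f i].

Lemma decomposes_ex v : exists f, decomposes v f.
Proof.
have [s [f [Vf ->]]] := grading_span gV v.
(* A degree may be listed several times in s, and f i then counts that often. *)
exists (fun i => iterop (count_mem i s) +%R (f i) 0); split.
  move=> i; case: (count_mem i s) => [|n]; first exact: grading0.
  elim: n => //= n IH; exact: gradingD.
exists (undup s); split; first exact: undup_uniq.
  by move=> i; rewrite mem_undup => /count_memPn ->.
by rewrite big_undup_iterop_count.
Qed.

Lemma decomposes_uniq v f g : decomposes v f -> decomposes v g -> f =1 g.
Proof.
move=> [Vf [s [us fs vs]]] [Vg [t [ut gt vt]]] i; apply/eqP; rewrite -subr_eq0.
apply/eqP; set S := undup (s ++ t).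
have [iS|iS] := boolP (i \in S); last first.
  move: iS; rewrite mem_undup mem_cat negb_or => /andP[i_s i_t].
  by rewrite fs // gt // subr0.
apply: (grading_free gV (s := S) (f := fun i => f i - g i)) => //.
- exact: undup_uniq.
- by move=> j; exact: (gradingB gV).
- rewrite sumrB (big_supp us _ _ fs) ?undup_uniq //; last first.
    by move=> j js; rewrite mem_undup mem_cat js.
  rewrite (big_supp ut _ _ gt) ?undup_uniq //; last first.
    by move=> j js; rewrite mem_undup mem_cat js orbT.
  by rewrite -vs -vt subrr.
Qed.

Definition hcomp (i : int) (v : V) : V := projT1 (cid (decomposes_ex v)) i.

Lemma hcomp_decomposes v : decomposes v (hcomp^~ v).
Proof. exact: projT2 (cid (decomposes_ex v)). Qed.

Lemma hcompP v f : decomposes v f -> forall i, hcomp i v = f i.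
Proof. by move=> vf; exact: decomposes_uniq (hcomp_decomposes v) vf. Qed.

Lemma hcomp_deg i v : V_ i (hcomp i v).
Proof. by have [] := hcomp_decomposes v. Qed.

Lemma hcomp_sum v : exists s, v = \sum_(i <- s) hcomp i v.
Proof. by have [_ [s [_ _ ?]]] := hcomp_decomposes v; exists s. Qed.

Lemma hcomp_bounded v : exists s : seq int, forall i, i \notin s -> hcomp i v = 0.
Proof. by have [_ [s [_ ? _]]] := hcomp_decomposes v; exists s. Qed.

Lemma hcomp_hom i j v : V_ i v -> hcomp j v = if j == i then v else 0.
Proof.
move=> Vv; apply: (@hcompP v (fun j => if j == i then v else 0)); split.
  by move=> k; case: eqP => [->|_] //; exact: grading0.
exists [:: i]; split=> //; last by rewrite big_seq1 eqxx.
by move=> k; rewrite inE => /negPf ->.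
Qed.

Lemma hcomp_id i v : V_ i v -> hcomp i v = v.
Proof. by move=> /hcomp_hom ->; rewrite eqxx. Qed.

Lemma hcomp_neq i j v : V_ i v -> j != i -> hcomp j v = 0.
Proof. by move=> /hcomp_hom -> /negPf ->. Qed.

Lemma hcompB i : zmod_morphism (hcomp i).
Proof.
move=> u v; apply: (@hcompP (u - v) (fun i => hcomp i u - hcomp i v)).
have [Vu [s [us su eu]]] := hcomp_decomposes u.
have [Vv [t [ut tv ev]]] := hcomp_decomposes v.
split; first by move=> j; exact: (gradingB gV).
exists (undup (s ++ t)); split; first exact: undup_uniq.
  move=> j; rewrite mem_undup mem_cat negb_or => /andP[js jt].
  by rewrite su // tv // subr0.
rewrite sumrB (big_supp us _ _ su) ?undup_uniq //; last first.
  by move=> j js; rewrite mem_undup mem_cat js.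
rewrite (big_supp ut _ _ tv) ?undup_uniq //; last first.
  by move=> j js; rewrite mem_undup mem_cat js orbT.
by rewrite -eu -ev.
Qed.

HB.instance Definition _ i := GRing.isZmodMorphism.Build V V (hcomp i) (hcompB i).

End Components.

Lemma hcomp_morph (V W : zmodType) V_ W_ (gV : @is_grading V V_)
    (gW : @is_grading W W_) (f : {additive V -> W}) :
  (forall i v, V_ i v -> W_ i (f v)) ->
  forall i v, hcomp gW i (f v) = f (hcomp gV i v).
Proof.
move=> fd i v; apply: (@hcompP W W_ gW (f v) (fun i => f (hcomp gV i v))).
have [Vv [s [us sv ev]]] := hcomp_decomposes gV v.
split; first by move=> j; exact: fd.
exists s; split=> // [j js|]; first by rewrite sv // raddf0.
by rewrite {1}ev raddf_sum.
Qed.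

Section GradedObjects.
Variables (R : pzRingType) (R_ : int -> R -> Prop).
Implicit Types L M N : gmod R_.

Definition gcomp M (i : int) (m : M) : M := hcomp (gmod_grading M) i m.
HB.instance Definition _ M i :=
  GRing.isZmodMorphism.Build M M (@gcomp M i) (hcompB (gmod_grading M) i).

Lemma gcomp_deg M i (m : M) : gmod_deg i (gcomp i m).
Proof. exact: hcomp_deg. Qed.

Lemma gcomp_id M i (m : M) : gmod_deg i m -> gcomp i m = m.
Proof. exact: hcomp_id. Qed.

Lemma gcomp_neq M i j (m : M) : gmod_deg i m -> j != i -> gcomp j m = 0.
Proof. exact: hcomp_neq. Qed.

Lemma gcomp_sum M (m : M) : exists s, m = \sum_(i <- s) gcomp i m.
Proof. exact: hcomp_sum. Qed.

Lemma gcomp_act M (i j : int) a (m : M) :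
  R_ i a -> gcomp (i + j) (a *: m) = a *: gcomp j m.
Proof.
move=> Ra; have [s ms] := gcomp_sum m.
rewrite {1}ms scaler_sumr raddf_sum {2}ms raddf_sum scaler_sumr.
apply: eq_bigr => k _ /=; have amk := gmod_act Ra (gcomp_deg k m).
have [<-|kj] := eqVneq k j.
  by rewrite (gcomp_id amk) (gcomp_id (gcomp_deg k m)).
rewrite (gcomp_neq amk) ?(inj_eq (addrI _)) 1?eq_sym //.
by rewrite (gcomp_neq (gcomp_deg k m)) 1?eq_sym // scaler0.
Qed.

Lemma gcomp_morph M N (f : {linear M -> N}) : degree_preserving f ->
  forall i m, gcomp i (f m) = f (gcomp i m).
Proof. by move=> fd i m; exact: hcomp_morph. Qed.

Definition graded_submod M (P : M -> Prop) : Prop :=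
  submod P /\ forall i m, P m -> P (gcomp i m).

Lemma submod_deg M i : (forall a, R_ 0 a) -> submod (@gmod_deg _ _ M i).
Proof.
move=> R0; split; first exact: grading0 (gmod_grading M) i.
move=> a x y Mx My; apply: (gradingD (gmod_grading M)) => //.
by rewrite -[i]add0r; exact: gmod_act.
Qed.

Section SubObject.
Variables (M : gmod R_) (P : M -> Prop) (gP : graded_submod P).
Let S := sub_mod gP.1.
Let i_ : {linear S -> M} := sub_incl gP.1.

Lemma sub_grading : is_grading (fun d (x : S) => gmod_deg d (i_ x)).
Proof.
have gM := gmod_grading M; split.
- by move=> d; rewrite raddf0; exact: grading0.
- by move=> d u v; rewrite raddfB; exact: gradingB.
- move=> v; have [s vs] := gcomp_sum (i_ v).
  have cP d : exists w : S, i_ w = gcomp d (i_ v).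
    by apply: sub_incl_surj; apply: gP.2; exact: sub_inclP.
  exists s, (fun d => projT1 (cid (cP d))); split=> [d|].
    by case: cid => w /= ->; exact: gcomp_deg.
  apply: (@sub_incl_inj _ _ _ gP.1); rewrite raddf_sum [LHS]vs.
  by apply: eq_bigr => d _; case: cid => w /= ->.
- move=> s f us fd f0 d ds; apply: (@sub_incl_inj _ _ _ gP.1).
  rewrite raddf0; apply: (grading_free gM (s := s) (f := fun d => i_ (f d))) => //.
  by rewrite -raddf_sum f0 raddf0.
Qed.

Lemma sub_act i j (a : R) (m : S) :
  R_ i a -> gmod_deg j (i_ m) -> gmod_deg (i + j) (i_ (a *: m)).
Proof. by move=> Ra mj; rewrite linearZ; exact: gmod_act. Qed.

Variable (fg : finitely_generated S).
Definition gsub : gmod R_ := @GMod R R_ S _ sub_grading sub_act fg.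
Definition gsub_incl : {linear gsub -> M} := i_.
End SubObject.

Section QuotientObject.
Variables (M : gmod R_) (P : M -> Prop) (gP : graded_submod P).
Let Q := quo_mod gP.1.
Let p_ : {linear M -> Q} := quo_map gP.1.

Definition quo_deg d (q : Q) : Prop := exists2 m, gmod_deg d m & p_ m = q.

Lemma quo_grading : is_grading quo_deg.
Proof.
have gM := gmod_grading M; split.
- by move=> d; exists 0; [exact: grading0 | exact: raddf0].
- move=> d _ _ [u du <-] [v dv <-].
  by exists (u - v); [exact: gradingB | exact: raddfB].
- move=> q; have [m <-] := quo_pi_surj q; have [s ms] := gcomp_sum m.
  exists s, (fun d => p_ (gcomp d m)); split=> [d|].
    by exists (gcomp d m) => //; exact: gcomp_deg.
  by rewrite -raddf_sum -ms.
- move=> s f us fd f0 d ds.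
  have fd' k : exists m, gmod_deg k m /\ p_ m = f k by have [m] := fd k; exists m.
  pose h k := projT1 (cid (fd' k)).
  have hP k : gmod_deg k (h k) /\ p_ (h k) = f k by exact: projT2 (cid (fd' k)).
  have : P (\sum_(k <- s) h k).
    apply/(quo_pi0 gP.1); rewrite -/(p_ _) raddf_sum -[RHS]f0.
    by apply: eq_bigr => k _; exact: (hP k).2.
  move/(gP.2 d); rewrite raddf_sum (bigD1_seq d) //= big1 ?addr0.
    by rewrite (gcomp_id (hP d).1) -(hP d).2 => /(quo_pi0 gP.1).
  by move=> k kd; rewrite (gcomp_neq (hP k).1) // eq_sym.
Qed.

Lemma quo_act i j (a : R) (q : Q) :
  R_ i a -> quo_deg j q -> quo_deg (i + j) (a *: q).
Proof.
move=> Ra [m mj <-]; exists (a *: m); first exact: gmod_act.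
exact: linearZ.
Qed.

Lemma quo_fg : finitely_generated Q.
Proof.
have [n [e eP]] := gmod_fg M; exists n, (fun i => p_ (e i)) => q.
have [m <-] := quo_pi_surj q; have [c ->] := eP m; exists c.
by rewrite -/(p_ _) linear_sum; apply: eq_bigr => i _; rewrite /= linearZ.
Qed.

Definition gquo : gmod R_ := @GMod R R_ Q _ quo_grading quo_act quo_fg.
Definition gquo_map : {linear M -> gquo} := p_.
End QuotientObject.

Lemma sub_quo_exact M P (gP : @graded_submod M P)
    (fg : finitely_generated (sub_mod gP.1)) :
  short_exact (gsub_incl fg) (gquo_map gP).
Proof.
split=> //.
- by move=> i m im; exists m.
- exact: sub_incl_inj.
- move=> m; split; first by move/quo_pi0/(sub_incl_surj gP.1) => [l <-]; exists l.
  by move=> [l ->]; apply/quo_pi0; exact: sub_inclP.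
- by move=> n; have [m <-] := quo_pi_surj n; exists m.
Qed.

Section ExactDegreewise.
Variables (L M N : gmod R_) (f : {linear L -> M}) (g : {linear M -> N}).
Hypothesis fg : short_exact f g.

Lemma exact_surj_deg d n : gmod_deg d n -> exists2 m, gmod_deg d m & g m = n.
Proof.
move=> dn; have [m nm] := ses_surj fg n; exists (gcomp d m).
  exact: gcomp_deg.
by rewrite -(gcomp_morph (ses_degr fg)) -nm gcomp_id.
Qed.

Lemma exact_inj_deg d l : gmod_deg d (f l) -> gmod_deg d l.
Proof.
move=> dl; suff -> : l = gcomp d l by exact: gcomp_deg.
by apply: (ses_inj fg); rewrite -(gcomp_morph (ses_degl fg)) gcomp_id.
Qed.

End ExactDegreewise.
End GradedObjects.

(** * Chains of submodules and bounded length *)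

Section Chains.
Variable R : pzRingType.

(** Chains 0 = P_0 <= ... <= P_m = P in which n of the steps are marked as
    satisfying C.  Unmarked steps are unrestricted, so that the image of a chain
    under an operation that destroys some marked steps is again a chain. *)
Inductive chain (M : lmodType R) (C : (M -> Prop) -> (M -> Prop) -> Prop) :
    nat -> (M -> Prop) -> Prop :=
| chain_nil P : (forall x, P x <-> x = 0) -> chain C 0 P
| chain_skip n P Q : chain C n P -> submod Q -> (forall x, P x -> Q x) ->
    chain C n Q
| chain_step n P Q : chain C n P -> submod Q -> (forall x, P x -> Q x) ->
    C P Q -> chain C n.+1 Q.

Lemma submod_ext (M : lmodType R) (P Q : M -> Prop) :
  (forall x, P x <-> Q x) -> submod P -> submod Q.
Proof.
move=> PQ sP; split; first by apply/PQ; exact: submod0.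
by move=> a x y /PQ Px /PQ Py; apply/PQ; exact: sP.2.
Qed.

Lemma chain_submod (M : lmodType R) C n (P : M -> Prop) : chain C n P -> submod P.
Proof.
case=> // {}P P0; apply: submod_ext (submod_zero M) => x.
by split=> /P0.
Qed.

(** Chains can be transported along any monotone operation F on submodules that
    turns marked steps into marked steps; the k steps below F 0 come in addition.
    With F the preimage under M -> N and a chain in its kernel below, this is the
    concatenation of chains.  The bound U gives the last hypothesis the
    information on Q that the caller has on P. *)
Lemma chain_map (M N : lmodType R) C C' (F : (M -> Prop) -> (N -> Prop))
    (U : M -> Prop) k :
  (forall P, submod P -> submod (F P)) ->
  (forall P Q, (forall x, P x -> Q x) -> forall y, F P y -> F Q y) ->
  (forall P, (forall x, P x <-> x = 0) -> chain C' k (F P)) ->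
  (forall P Q, submod P -> submod Q -> (forall x, P x -> Q x) ->
     (forall x, Q x -> U x) -> C P Q -> C' (F P) (F Q)) ->
  forall n P, (forall x, P x -> U x) -> chain C n P -> chain C' (n + k) (F P).
Proof.
move=> Fs Fm F0 FC n P PU cP; elim: cP PU => {n P} [P P0 _|n P Q cP IH sQ PQ QU|].
- exact: F0.
- apply: chain_skip (IH _) (Fs _ sQ) (Fm _ _ PQ) => x Px.
  by apply: QU; exact: PQ.
- move=> n P Q cP IH sQ PQ CPQ QU.
  apply: chain_step (IH _) (Fs _ sQ) (Fm _ _ PQ) _ => [x Px|].
    by apply: QU; exact: PQ.
  by apply: FC => //; exact: chain_submod cP.
Qed.

Lemma chain_sub (M : lmodType R) (C C' : (M -> Prop) -> (M -> Prop) -> Prop) n P :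
  (forall P Q, C P Q -> C' P Q) -> chain C n P -> chain C' n P.
Proof.
move=> CC'; elim=> {n P} [P P0|n P Q _ IH sQ PQ|n P Q _ IH sQ PQ /CC'].
- exact: chain_nil.
- exact: chain_skip IH sQ PQ.
- exact: chain_step.
Qed.

Definition strict_sub (M : lmodType R) (P Q : M -> Prop) : Prop :=
  exists2 x, Q x & ~ P x.

Definition length_le (M : lmodType R) (b : nat) : Prop :=
  forall n (P : M -> Prop), chain (@strict_sub M) n P -> (n <= b)%N.

(** Bounded length makes every module Noetherian: without a finite generating
    family, generators outside the span of the previous ones could be adjoined
    forever. *)
Lemma length_le_fg (M : lmodType R) b : length_le M b -> finitely_generated M.
Proof.
move=> lM; apply: contrapT => nfg.
suff H n : exists e : 'I_n -> M,
    chain (@strict_sub M) n (fun m => exists c : 'I_n -> R, m = \sum_i c i *: e i).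
  by have [e /lM] := H b.+1; rewrite ltnn.
elim: n => [|n [e ce]].
  exists (fun=> 0); apply: chain_nil => m; split=> [[c ->]|->].
    by rewrite big_ord0.
  by exists (fun=> 0); rewrite big_ord0.
have [v vP] : exists v, ~ exists c : 'I_n -> R, v = \sum_i c i *: e i.
  apply: contrapT => nv; apply: nfg; exists n, e => m.
  by apply: contrapT => nm; apply: nv; exists m.
exists (fun i => if unlift ord0 i is Some j then e j else v).
have sumE (c : 'I_n.+1 -> R) :
    \sum_i c i *: (if unlift ord0 i is Some j then e j else v)
    = c ord0 *: v + \sum_i c (lift ord0 i) *: e i.
  rewrite big_ord_recl unlift_none; congr (_ + _).
  by apply: eq_bigr => i _; rewrite liftK.
apply: chain_step ce _ _ _.
- split; first by exists (fun=> 0); rewrite big1 // => i _; rewrite scale0r.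
  move=> a x y [c ->] [d ->]; exists (fun i => a * c i + d i).
  rewrite scaler_sumr -big_split; apply: eq_bigr => i _ /=.
  by rewrite scalerDl scalerA.
- move=> x [c ->]; exists (fun i => if unlift ord0 i is Some j then c j else 0).
  rewrite sumE unlift_none scale0r add0r.
  by apply: eq_bigr => i _; rewrite liftK.
- exists v => //; exists (fun i => if unlift ord0 i is Some j then 0 else 1).
  rewrite sumE unlift_none scale1r big1 ?addr0 // => i _.
  by rewrite liftK scale0r.
Qed.

(** A chain in a submodule other than M extends by a strict step up to M, and
    dually for quotients; this is what makes the length decrease. *)
Lemma length_le_sub (M : lmodType R) b (P : M -> Prop) (sP : submod P) :
  length_le M b.+1 -> (exists x, ~ P x) -> length_le (sub_mod sP) b.
Proof.
move=> lM [x nPx] n Q cQ; rewrite -ltnS; apply: (lM _ (fun=> True)).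
apply: (@chain_step M _ n P) => //; last by exists x.
apply: (@chain_skip M _ n (fun y => exists2 z, Q z & sub_incl sP z = y)) => //.
  rewrite -[n]addn0.
  apply: (@chain_map _ _ (@strict_sub (sub_mod sP)) (@strict_sub M) (fun Q y =>
    exists2 z, Q z & sub_incl sP z = y) (fun=> True)) cQ => // {Q}.
  - by move=> Q; exact: submod_image.
  - by move=> Q Q' QQ' y [z Qz <-]; exists z => //; exact: QQ'.
  - move=> Q Q0; apply: chain_nil => y; split=> [[z /Q0 -> <-]|->].
      exact: raddf0.
    by exists 0; [exact/Q0 | exact: raddf0].
  - move=> Q Q' _ _ _ _ [z Qz nQz]; exists (sub_incl sP z); first by exists z.
    by move=> [t Qt /sub_incl_inj tz]; apply: nQz; rewrite -tz.
by move=> _ [z _ <-]; exact: sub_inclP.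
Qed.

Lemma length_le_quo (M : lmodType R) b (P : M -> Prop) (sP : submod P) :
  length_le M b.+1 -> (exists2 x, P x & x <> 0) -> length_le (quo_mod sP) b.
Proof.
move=> lM [x Px nx] n Q cQ; rewrite -ltnS; apply: (lM _ (fun x => Q (quo_map sP x))).
rewrite -addn1; apply: (@chain_map _ _ (@strict_sub (quo_mod sP)) (@strict_sub M)
  (fun Q x => Q (quo_map sP x)) (fun=> True)) cQ => // {Q}.
- by move=> Q; exact: submod_preim.
- by move=> Q Q' QQ' y; exact: QQ'.
- move=> Q Q0; apply: (@chain_step M _ 0 (fun x => x = 0)).
  + exact: chain_nil.
  + apply: (@submod_preim _ _ _ (quo_map sP)).
    by apply: submod_ext (submod_zero _) => y; split=> /Q0.
  + by move=> y ->; apply/Q0; exact: raddf0.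
  + by exists x => //; apply/Q0/quo_pi0.
- move=> Q Q' _ _ _ _ [z Qz nQz]; have [y yz] := quo_pi_surj z.
  by exists y; rewrite /quo_map /= yz.
Qed.

Lemma length_le0 (M : lmodType R) : length_le M 0 -> forall x : M, x = 0.
Proof.
move=> lM x; apply: contrapT => nx; suff : (1 <= 0)%N by [].
apply: (lM 1 (fun=> True)).
apply: (@chain_step M _ 0 (fun x => x = 0)) => //; last by exists x.
exact: chain_nil.
Qed.

End Chains.

Section FiniteDimensional.
Variables (K : fieldType) (A : falgType K) (M : lmodType A).

Lemma fg_span : finitely_generated M ->
  exists n (e : 'I_n -> M), forall m, exists c : 'rV[K]_n,
    m = \sum_i (c 0 i)%:A *: e i.
Proof.
case=> n [e eP]; pose I : finType := ('I_n * 'I_(\dim {:A}))%type.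
pose b := vbasis {:A}; pose e' (p : I) : M := b`_p.2 *: e p.1.
exists #|I|, (fun k => e' (enum_val k)) => m.
have [c ->] := eP m.
pose d (p : I) := coord b p.2 (c p.1).
exists (\row_k d (enum_val k)).
transitivity (\sum_(p : I) (d p)%:A *: e' p).
  rewrite -(pair_bigA _ (fun i j => (d (i, j))%:A *: e' (i, j))) /=.
  apply: eq_bigr => i _; rewrite {1}(coord_vbasis (memvf (c i))) scaler_suml.
  by apply: eq_bigr => j _; rewrite scalerA -scalerAl mul1r.
rewrite (reindex (@enum_val I I)) /=; last by apply: onW_bij; exact: enum_val_bij.
by apply: eq_bigr => k _; rewrite mxE.
Qed.

(** A submodule pulls back to a subspace of K^d along a spanning family of d
    vectors, and every strict step of a chain raises the rank of the subspaces
    pulled back. *)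
Lemma fg_length : finitely_generated M -> exists b, length_le M b.
Proof.
move=> /fg_span[d [e eP]]; exists d => n P cP.
pose lin (v : 'rV[K]_d) := \sum_i (v 0 i)%:A *: e i.
have linP a v w : lin (a *: v + w) = a%:A *: lin v + lin w.
  rewrite /lin scaler_sumr -big_split; apply: eq_bigr => i _ /=.
  by rewrite !mxE scalerDl scalerDl scalerA -scalerAl mul1r scalerA.
suff [B [nB _]] : exists B : 'M[K]_d, (n <= \rank B)%N /\
    forall v : 'rV_d, (v <= B)%MS -> P (lin v).
  exact: leq_trans nB (rank_leq_row B).
elim: cP => {n P} [P P0|n P Q _ [B [nB BP]] sQ PQ|n P Q cP [B [nB BP]] sQ PQ].
- exists 0; split=> [|v]; first by [].
  rewrite submx0 => /eqP ->; apply/P0.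
  by rewrite /lin big1 // => i _; rewrite mxE scale0r scale0r.
- by exists B; split=> // v vB; apply: PQ; exact: BP.
- move=> [x Qx nPx]; have [w xw] := eP x.
  exists (B + w)%MS; split.
    apply: leq_ltn_trans nB _; suff : (B < B + w)%MS.
      by rewrite ltmxErank => /andP[].
    rewrite /ltmx addsmxSl /=; apply/negP => BwB; apply: nPx; rewrite xw.
    by apply: BP; apply: submx_trans BwB; exact: addsmxSr.
  move=> v /sub_addsmxP[[u1 u2] /= ->].
  rewrite addrC [u2]mx11_scalar mul_scalar_mx linP.
  apply: sQ.2; first by rewrite -[lin w]xw.
  by apply/PQ/BP; exact: submxMl.
Qed.

End FiniteDimensional.

(** * Multiplicities of a simple module *)

Section Factors.
Variable R : pzRingType.

Definition linrel (M N : lmodType R) (r : M -> N -> Prop) : Prop :=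
  r 0 0 /\ forall a x y x' y', r x x' -> r y y' -> r (a *: x + y) (a *: x' + y').

Lemma linrelB (M N : lmodType R) (r : M -> N -> Prop) x y x' y' :
  linrel r -> r x x' -> r y y' -> r (x - y) (x' - y').
Proof.
move=> [_ rP] rx ry; have := rP (-1) _ _ _ _ ry rx.
by rewrite !scaleN1r ![- _ + _]addrC.
Qed.

(** The relation r is an isomorphism of Q / P with U, seen as a correspondence
    between M and S.  Correspondences restrict to submodules and compose with linear
    maps in both directions, without quotient modules or partial inverses. *)
Record iso_factor (M S : lmodType R) (P Q : M -> Prop) (U : S -> Prop)
    (r : M -> S -> Prop) : Prop := IsoFactor {
  isof_lin : linrel r;
  isof_dom : forall x, Q x <-> exists s, r x s;
  isof_img : forall s, U s <-> exists x, r x s;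
  isof_ker : forall x, P x <-> r x 0;
  isof_fun : forall s, r 0 s -> s = 0
}.

Definition factor (S : lmodType R) (U : S -> Prop) (M : lmodType R)
  (P Q : M -> Prop) : Prop := exists r, iso_factor P Q U r.

Record simple_submod (S : lmodType R) (U : S -> Prop) : Prop := SimpleSubmod {
  ssub_submod : submod U;
  ssub_neq0 : exists2 s, U s & s <> 0;
  ssub_min : forall P, submod P -> (forall x, P x -> U x) ->
    (forall x, P x -> x = 0) \/ (forall x, U x -> P x)
}.

Lemma factor_strict (M S : lmodType R) (P Q : M -> Prop) (U : S -> Prop) :
  simple_submod U -> factor U P Q -> strict_sub P Q.
Proof.
move=> [_ [s Us ns] _] [r ir]; have [x xs] := (isof_img ir s).1 Us.
exists x; first by apply/(isof_dom ir); exists s.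
move=> /(isof_ker ir) x0; apply/ns/(isof_fun ir).
by have := linrelB (isof_lin ir) xs x0; rewrite subrr subr0.
Qed.

Lemma factor_self (S : lmodType R) (U : S -> Prop) :
  submod U -> factor U (fun x => x = 0) U.
Proof.
move=> sU; exists (fun x s => U x /\ s = x); split.
- split=> [|a x y x' y' [Ux ->] [Uy ->]]; first by split; first exact: submod0.
  by split=> //; exact: sU.2.
- by move=> x; split=> [Ux|[s []//]]; exists x.
- by move=> s; split=> [Us|[x [Ux ->]]//]; exists s.
- by move=> x; split=> [->|[_ ->]//]; split=> //; exact: submod0.
- by move=> s [].
Qed.

Lemma factor_image (L M S : lmodType R) (f : {linear L -> M}) (U : S -> Prop) P Q :
  injective f -> submod P -> factor U P Q ->
  factor U (fun y => exists2 x, P x & f x = y) (fun y => exists2 x, Q x & f x = y).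
Proof.
move=> fi sP [r ir]; exists (fun y s => exists2 x, r x s & f x = y); split.
- split; first by exists 0; [exact: (isof_lin ir).1 | exact: raddf0].
  move=> a _ _ x' y' [x rx <-] [y ry <-].
  by exists (a *: x + y); [exact: (isof_lin ir).2 | exact: linearP].
- move=> y; split=> [[x /(isof_dom ir)[s rs] xy]|[s [x rx xy]]].
    by exists s, x.
  by exists x => //; apply/(isof_dom ir); exists s.
- move=> s; split=> [/(isof_img ir)[x rx]|[y [x rx _]]].
    by exists (f x), x.
  by apply/(isof_img ir); exists x.
- by move=> y; split=> [[x /(isof_ker ir) rx xy]|[x /(isof_ker ir) rx xy]]; exists x.
- move=> s [x rx fx0]; apply: (isof_fun ir); rewrite -(_ : x = 0) //.
  by apply: fi; rewrite fx0 raddf0.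
Qed.

Lemma factor_preim (M N S : lmodType R) (g : {linear M -> N}) (D : M -> Prop)
    (U : S -> Prop) P Q :
  submod D -> (forall y, Q y -> exists2 x, D x & g x = y) -> factor U P Q ->
  factor U (fun x => D x /\ P (g x)) (fun x => D x /\ Q (g x)).
Proof.
move=> sD gD [r ir]; exists (fun x s => D x /\ r (g x) s); split.
- split; first by split; [exact: submod0 | rewrite raddf0; exact: (isof_lin ir).1].
  move=> a x y x' y' [Dx rx] [Dy ry]; split; first exact: sD.2.
  by rewrite linearP; exact: (isof_lin ir).2.
- move=> x; split=> [[Dx /(isof_dom ir)[s rs]]|[s [Dx rx]]]; first by exists s.
  by split=> //; apply/(isof_dom ir); exists s.
- move=> s; split=> [/(isof_img ir)[y rys]|[x [Dx rx]]].
    have /gD[x Dx xy] : Q y by apply/(isof_dom ir); exists s.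
    by exists x; rewrite xy.
  by apply/(isof_img ir); exists (g x).
- by move=> x; split=> -[Dx /(isof_ker ir) rx].
- by move=> s []; rewrite raddf0 => _; exact: (isof_fun ir).
Qed.

Section ExactSequence.
Variables (L M N S : lmodType R) (f : {linear L -> M}) (g : {linear M -> N}).
Hypothesis (fi : injective f) (fg : forall m, g m = 0 <-> exists l, m = f l).
Variables (U : S -> Prop) (sU : simple_submod U).

(** A step r : Q / P = U of a chain in M restricts to L, where its image is a
    submodule of U.  If that is U, the step survives in L; if it is 0, then r
    factors through g and the step survives in N. *)
Lemma chain_split n Q : chain (factor U (M := M)) n Q ->
  exists n1 n2, [/\ (n <= n1 + n2)%N, chain (factor U (M := L)) n1 (fun x => Q (f x))
    & chain (factor U (M := N)) n2 (fun y => exists2 x, Q x & g x = y)].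
Proof.
elim=> {n Q} [P P0|n P Q _ [n1 [n2 [le c1 c2]]] sQ PQ|].
- exists 0%N, 0%N; split=> //; apply: chain_nil => x.
    split=> [/P0 fx0|->]; first by apply: fi; rewrite fx0 raddf0.
    by apply/P0; exact: raddf0.
  split=> [[y /P0 -> <-]|->]; first exact: raddf0.
  by exists 0; [exact/P0 | exact: raddf0].
- exists n1, n2; split=> //.
    by apply: chain_skip c1 (submod_preim f sQ) _ => x; exact: PQ.
  apply: chain_skip c2 (submod_image g sQ) _ => y [x Px <-].
  by exists x => //; exact: PQ.
move=> n P Q _ [n1 [n2 [le c1 c2]]] sQ PQ [r ir].
have sL : submod (fun s => exists l, r (f l) s).
  split; first by exists 0; rewrite raddf0; exact: (isof_lin ir).1.
  move=> a x y [l lx] [l' ly]; exists (a *: l + l'); rewrite linearP.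
  exact: (isof_lin ir).2.
have LU s : (exists l, r (f l) s) -> U s.
  by move=> [l ls]; apply/(isof_img ir); exists (f l).
have [L0|UL] := ssub_min sU sL LU.
- exists n1, n2.+1; split; first by rewrite addnS ltnS.
    by apply: chain_skip c1 (submod_preim f sQ) _ => x; exact: PQ.
  apply: chain_step c2 (submod_image g sQ) _ _ => [y [x Px <-]|].
    by exists x => //; exact: PQ.
  exists (fun y s => exists2 x, r x s & g x = y); split.
  + split; first by exists 0; [exact: (isof_lin ir).1 | exact: raddf0].
    move=> a _ _ x' y' [x rx <-] [y ry <-].
    by exists (a *: x + y); [exact: (isof_lin ir).2 | exact: linearP].
  + move=> y; split=> [[x /(isof_dom ir)[s rs] xy]|[s [x rx xy]]].
      by exists s, x.
    by exists x => //; apply/(isof_dom ir); exists s.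
  + move=> s; split=> [/(isof_img ir)[x rx]|[y [x rx _]]].
      by exists (g x), x.
    by apply/(isof_img ir); exists x.
  + by move=> y; split=> [[x /(isof_ker ir) rx xy]|[x /(isof_ker ir) rx xy]]; exists x.
  + by move=> s [x rx /fg[l xl]]; apply: L0; exists l; rewrite -xl.
- exists n1.+1, n2; split; first by rewrite addSn ltnS.
    apply: chain_step c1 (submod_preim f sQ) _ _ => [x|]; first exact: PQ.
    exists (fun x s => r (f x) s); split.
    + split; first by rewrite raddf0; exact: (isof_lin ir).1.
      by move=> a x y x' y' rx ry; rewrite linearP; exact: (isof_lin ir).2.
    + by move=> x; exact: (isof_dom ir).
    + by move=> s; split=> [/UL|/LU].
    + by move=> x; exact: (isof_ker ir).
    + by move=> s; rewrite raddf0; exact: (isof_fun ir).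
  apply: chain_skip c2 (submod_image g sQ) _ => y [x Px <-].
  by exists x => //; exact: PQ.
Qed.

End ExactSequence.

Lemma chain_zero (M S : lmodType R) (U : S -> Prop) (Q : M -> Prop) n :
  simple_submod U -> chain (factor U (M := M)) n Q -> (forall x, Q x -> x = 0) ->
  n = 0%N.
Proof.
move=> sU; elim=> {n Q} // [n P Q _ IH _ PQ Q0|n P Q cP _ _ _ PQ Q0].
  by apply: IH => x Px; apply: Q0; exact: PQ.
have [x /Q0 -> nP0] := factor_strict sU PQ.
by case: nP0; exact: submod0 (chain_submod cP).
Qed.

(** The members of a chain in a simple Q are 0 or Q, so at most one step is
    strict, and that step is all of Q. *)
Lemma chain_simple (M S : lmodType R) (U : S -> Prop) (Q : M -> Prop) n :
  simple_submod U -> simple_submod Q -> chain (factor U (M := M)) n Q ->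
  (n <= 1)%N /\ (n = 1%N -> factor U (fun x => x = 0) Q).
Proof.
move=> sU sQ cQ.
have [V QeV] : exists V, Q = V by exists Q.
have sV : simple_submod V by rewrite -QeV.
have QV x : Q x -> V x by rewrite QeV.
have VQ x : V x -> Q x by rewrite QeV.
rewrite QeV; suff {QeV} : n = 0%N \/ n = 1%N /\ factor U (fun x => x = 0) V.
  by case=> [->|[->]].
elim: cQ {sQ} QV VQ => {n Q} [P _ _ _|n P Q cP IH sQ PQ QV VQ|]; first by left.
  have [P0|VP] := ssub_min sV (chain_submod cP) (fun x Px => QV x (PQ x Px)).
    by left; exact: chain_zero sU cP P0.
  by apply: IH => // x Px; exact/QV/PQ.
move=> n P Q cP IH sQ PQ fPQ QV VQ; right.
have QeV : Q = V.
  by apply: funext => x; apply: propext; split; [exact: QV | exact: VQ].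
have [P0|VP] := ssub_min sV (chain_submod cP) (fun x Px => QV x (PQ x Px)).
  rewrite (chain_zero sU cP P0); split=> //; rewrite -QeV.
  rewrite -(_ : P = fun x => x = 0) //; apply: funext => x; apply: propext.
  by split=> [/P0 //|->]; exact: submod0 (chain_submod cP).
have [x Qx nPx] := factor_strict sU fPQ.
by case: nPx; exact/VP/QV.
Qed.

End Factors.

Section Multiplicity.
Variables (K : fieldType) (B : falgType K) (B_ : int -> B -> Prop).
Hypothesis B0 : forall a, B_ 0 a.
Variables (S : lmodType B) (U : S -> Prop) (sU : simple_submod U) (d : int).
Implicit Types L M N : gmod B_.

Lemma chain0_deg M : exists n, `[< chain (factor U (M := M)) n (gmod_deg d) >].
Proof.
exists 0%N; apply: asboolT.
apply: (@chain_skip _ _ _ 0 (fun x : M => x = 0)); first exact: chain_nil.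
  exact: submod_deg.
by move=> x ->; exact: grading0 (gmod_grading M) d.
Qed.

Lemma mult_bounded M : exists b,
  forall n, `[< chain (factor U (M := M)) n (gmod_deg d) >] -> (n <= b)%N.
Proof.
have [b lb] := fg_length (gmod_fg M); exists b => n /asboolW cn.
by apply: (lb n (gmod_deg d)); apply: chain_sub cn => P Q; exact: factor_strict.
Qed.

Definition mult M : nat :=
  ex_maxn (chain0_deg M) (projT2 (cid (mult_bounded M))).

Lemma mult_chain M : chain (factor U (M := M)) (mult M) (gmod_deg d).
Proof. by rewrite /mult; case: ex_maxnP => n /asboolW. Qed.

Lemma mult_max M n : chain (factor U (M := M)) n (gmod_deg d) -> (n <= mult M)%N.
Proof. by rewrite /mult; case: ex_maxnP => m _ mm cn; apply: mm; exact: asboolT. Qed.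

(** The first inequality splits a maximal chain of M_d; the second puts the
    preimage of a maximal chain of N_d on top of the image of one of L_d. *)
Lemma mult_exact L M N (f : {linear L -> M}) (g : {linear M -> N}) :
  short_exact f g -> mult M = (mult L + mult N)%N.
Proof.
move=> fg; apply/eqP; rewrite eqn_leq; apply/andP; split.
  have [n1 [n2 [le c1 c2]]] :=
    chain_split (ses_inj fg) (ses_mid fg) sU (mult_chain M).
  apply: leq_trans le (leq_add _ _); apply: mult_max.
    by apply: chain_skip c1 (submod_deg _ _ B0) _ => x; exact: (exact_inj_deg fg).
  apply: chain_skip c2 (submod_deg _ _ B0) _ => _ [x dx <-].
  exact: (ses_degr fg).
apply: mult_max; rewrite addnC.
apply: (@chain_skip _ _ _ _ (fun x => gmod_deg d x /\ gmod_deg d (g x))) _ _; last 1 first.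
- by move=> x [].
- apply: (@chain_map _ _ _ _ (factor U (M := M)) (fun P x => gmod_deg d x /\ P (g x))
    (gmod_deg d)) (mult_chain N) => //.
  + by move=> P sP; apply: submod_and; [exact: submod_deg | exact: submod_preim].
  + by move=> P Q PQ x [dx Px]; split=> //; exact: PQ.
  + move=> P P0.
    apply: (@chain_skip _ _ _ _ (fun y => exists2 x, gmod_deg d x & f x = y)).
    * rewrite -[mult L]addn0.
      apply: (@chain_map _ _ _ _ (factor U (M := M))
        (fun P y => exists2 x, P x & f x = y) (gmod_deg d)) (mult_chain L) => //.
      - by move=> Q; exact: submod_image.
      - by move=> Q Q' QQ' y [x Qx <-]; exists x => //; exact: QQ'.
      - move=> Q Q0; apply: chain_nil => y; split=> [[x /Q0 -> <-]|->].
          exact: raddf0.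
        by exists 0; [exact/Q0 | exact: raddf0].
      - by move=> Q Q' sQ _ _ _; exact: factor_image (ses_inj fg) sQ.
    * apply: submod_and; first exact: submod_deg.
      apply: submod_preim; apply: submod_ext (submod_zero _) => x.
      by split=> /P0.
    * move=> _ [x dx <-]; split; first exact: (ses_degl fg).
      by apply/P0/(ses_mid fg); exists x.
  + move=> P Q sP sQ PQ Qd; apply: factor_preim; first exact: submod_deg.
    by move=> y /Qd; exact: (exact_surj_deg fg).
- exact: submod_deg.
Qed.

Definition word_mult (w : word B_) : int :=
  \sum_(p <- w) (if p.1 then (mult p.2)%:Z else - (mult p.2)%:Z).

Lemma word_mult_k0 x y : k0_eq x y -> word_mult x = word_mult y.
Proof.
rewrite /word_mult; elim=> {x y} //.
- by move=> x y z _ -> _.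
- by move=> x x' y y' _ exx _ eyy; rewrite !big_cat /= exx eyy.
- by move=> x y; rewrite !big_cat /= addrC.
- by move=> M; rewrite !big_cons !big_nil /= addr0 subrr.
- move=> L M N f g fg; rewrite !big_cons !big_nil /= !addr0.
  by rewrite (mult_exact fg) PoszD.
Qed.

End Multiplicity.

(** * Words of simple graded modules *)

Section K0Words.
Variables (R : pzRingType) (R_ : int -> R -> Prop).
Implicit Types (L M N : gmod R_) (w : word R_).

Lemma k0_cancel b M w : k0_eq ((b, M) :: (~~ b, M) :: w) w.
Proof.
have H := k0_cat (k0_eq_flip [:: (b, M)]) (k0_refl w).
exact: H.
Qed.

Lemma k0_cons p w w' : k0_eq w w' -> k0_eq (p :: w) (p :: w').
Proof. by move=> ww'; exact: (k0_cat (k0_refl [:: p]) ww'). Qed.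

Lemma k0_move p w1 w2 : k0_eq (w1 ++ p :: w2) (p :: w1 ++ w2).
Proof.
have := k0_cat (k0_comm w1 [:: p]) (k0_refl w2).
by rewrite -catA.
Qed.

Lemma k0_subr_eq w w' : k0_eq (w ++ flip w') [::] -> k0_eq w w'.
Proof.
move=> ww0; apply: (@k0_trans _ _ _ (w ++ (flip w' ++ w'))).
  rewrite -{1}[w]cats0; apply: k0_cat (k0_refl _) _.
  exact: k0_sym (k0_trans (k0_comm _ _) (k0_eq_flip w')).
by rewrite catA; exact: (k0_cat ww0 (k0_refl w')).
Qed.

(** The sequence 0 -> M -> M -> M -> 0 of identities is exact for M = 0, and gives
    [M] = [M] + [M]. *)
Lemma k0_zero_obj M : (forall m : M, m = 0) -> k0_eq [:: (true, M)] [::].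
Proof.
move=> M0.
have ex : @short_exact _ _ M M M idfun idfun.
  split=> // [m|n]; last by exists n.
  by split=> _; [exists m | exact: M0].
have H := k0_cat (k0_ses ex) (k0_refl [:: (false, M)]).
apply: k0_sym; apply: k0_trans (k0_sym (k0_cancel true M [::])) _.
apply: k0_trans H _; rewrite /=.
exact: k0_cons (k0_cancel true M [::]).
Qed.

(** In 0 -> M -> N -> N / N -> 0 the last term is a zero object. *)
Lemma k0_iso M N (f : {linear M -> N}) : degree_preserving f ->
  injective f -> (forall n, exists m, n = f m) ->
  k0_eq [:: (true, M)] [:: (true, N)].
Proof.
move=> fd fi fs.
have gT : graded_submod (fun _ : N => True) by split.
have Z0 (z : gquo gT) : z = 0.
  by have [n <-] := quo_pi_surj z; apply/(quo_pi0 gT.1).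
have ex : short_exact f (gquo_map gT).
  split=> //.
  - by move=> i n ni; exists n.
  - by move=> z; have [n <-] := quo_pi_surj z; exists n.
apply: k0_sym; apply: k0_trans (k0_ses ex) _.
exact: k0_cons (k0_zero_obj Z0).
Qed.

Lemma k0_swap_sign b M N : k0_eq [:: (true, M)] [:: (true, N)] ->
  k0_eq [:: (b, M)] [:: (b, N)].
Proof. by case: b => // /k0_flip_compat. Qed.

Definition gsimple M : Prop :=
  (exists m : M, m <> 0) /\
  forall P, graded_submod P -> (forall m : M, P m -> m = 0) \/ (forall m, P m).

Definition simple_word w : Prop := List.Forall (fun p => gsimple p.2) w.

Lemma simple_word_cat w w' : simple_word (w ++ w') <-> simple_word w /\ simple_word w'.
Proof. exact: List.Forall_app. Qed.

(** A module that is neither zero nor simple has a graded submodule which, like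
    the quotient by it, has smaller length. *)
Lemma length_k0_simple b M : length_le M b ->
  exists w, simple_word w /\ k0_eq [:: (true, M)] w.
Proof.
elim: b M => [|b IH] M lM.
  exists [::]; split; first exact: List.Forall_nil.
  by apply: k0_zero_obj; exact: length_le0 lM.
have [M0|nM0] := pselect (forall m : M, m = 0).
  by exists [::]; split; [exact: List.Forall_nil | exact: k0_zero_obj].
have [sM|nsM] := pselect (gsimple M).
  exists [:: (true, M)]; split; last exact: k0_refl.
  by apply: List.Forall_cons => //; exact: List.Forall_nil.
have [P [gP [P0 PM]]] : exists P : M -> Prop,
    graded_submod P /\ (exists2 x, P x & x <> 0) /\ (exists x, ~ P x).
  apply: contrapT => nP; apply: nsM; split.
    by apply: contrapT => nm; apply: nM0 => m; apply: contrapT => ?; apply: nm; exists m.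
  move=> P gP; have [P0|nP0] := pselect (forall m : M, P m -> m = 0); [by left|right].
  move=> m; apply: contrapT => nPm; apply: nP; exists P; split=> //.
  split; last by exists m.
  apply: contrapT => np; apply: nP0 => x Px.
  by apply: contrapT => nx; apply: np; exists x.
have lS := length_le_sub (sP := gP.1) lM PM; have lQ := length_le_quo (sP := gP.1) lM P0.
have fS := length_le_fg lS.
have [w1 [s1 e1]] := IH (gsub fS) lS.
have [w2 [s2 e2]] := IH (gquo gP) lQ.
exists (w1 ++ w2); split; first exact/simple_word_cat.
apply: k0_trans (k0_ses (sub_quo_exact fS)) _.
exact: (k0_cat e1 e2).
Qed.

Lemma simple_word_flip w : simple_word w -> simple_word (flip w).
Proof. by rewrite /simple_word /flip => sw; apply/List.Forall_map; exact: sw. Qed.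

End K0Words.

Lemma word_k0_simple (K : fieldType) (A : falgType K) (A_ : int -> A -> Prop)
    (w : word A_) :
  exists w', simple_word w' /\ k0_eq w w'.
Proof.
elim: w => [|[b M] w [w' [sw' ww']]].
  by exists [::]; split; [exact: List.Forall_nil | exact: k0_refl].
have [n lM] := fg_length (gmod_fg M).
have [v [sv Mv]] := length_k0_simple lM.
exists ((if b then v else flip v) ++ w'); split.
  apply/simple_word_cat; split=> //.
  by case: b => //; exact: simple_word_flip.
apply: (@k0_cat _ _ [:: (b, M)]) => //.
by case: b => //; exact: (k0_flip_compat Mv).
Qed.

(** * Top degrees and the triangular decomposition *)

Section TopDegree.
Variables (K : fieldType) (A : falgType K) (A_ : int -> {vspace A}).
Hypothesis gA : graded_algebra A_.
Implicit Types L M : gmod (alg_deg A_).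

Lemma alg_deg_scalar (k : K) : alg_deg A_ 0 k%:A.
Proof. by rewrite /alg_deg memvZ ?(galg_one gA). Qed.

Lemma gmod_degZ M i (k : K) (m : M) : gmod_deg i m -> gmod_deg i (k%:A *: m).
Proof. by rewrite -{2}[i]add0r; apply: gmod_act; exact: alg_deg_scalar. Qed.

Lemma gcompZ M i (k : K) (m : M) : gcomp i (k%:A *: m) = k%:A *: gcomp i m.
Proof. by rewrite -{1}[i]add0r gcomp_act //; exact: alg_deg_scalar. Qed.

Definition vanishes_above (d : int) M : Prop :=
  forall j (m : M), (d < j)%R -> gmod_deg j m -> m = 0.

(** Over K the module is spanned by finitely many vectors, each with finitely many
    components. *)
Lemma finite_support M :
  exists s : seq int, forall j (m : M), j \notin s -> gmod_deg j m -> m = 0.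
Proof.
have [n [e eP]] := fg_span (gmod_fg M).
have eb k : exists s : seq int, forall i, i \notin s -> gcomp i (e k) = 0.
  exact: hcomp_bounded.
pose s k := projT1 (cid (eb k)).
have sP k i : i \notin s k -> gcomp i (e k) = 0 by exact: (projT2 (cid (eb k))).
exists (flatten [seq s k | k : 'I_n]) => j m js jm.
rewrite -(gcomp_id jm); have [c ->] := eP m.
rewrite raddf_sum big1 // => k _; rewrite [LHS]gcompZ sP ?scaler0 //.
apply: contra js => jk; apply/flattenP; exists (s k) => //.
by apply/mapP; exists k => //; rewrite mem_enum.
Qed.

Lemma seq_max (r : seq int) : r != [::] ->
  exists2 d, d \in r & forall j, j \in r -> (j <= d)%R.
Proof.
elim: r => // i r IH _; have [->|/IH[d dr dP]] := eqVneq r [::].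
  by exists i => [|j]; rewrite !inE // => /eqP ->.
have [di|id] := leP d i.
  exists i => [|j]; rewrite inE ?eqxx // => /predU1P[-> //|/dP jd].
  exact: le_trans di.
exists d => [|j]; rewrite inE ?dr ?orbT // => /predU1P[->|/dP //].
exact: ltW.
Qed.

Lemma top_degree M : (exists m : M, m <> 0) ->
  exists d, vanishes_above d M /\ exists2 m : M, gmod_deg d m & m <> 0.
Proof.
move=> [m0 nm0]; have [s sP] := finite_support M.
pose nz j := exists2 m : M, gmod_deg j m & m <> 0.
have nzs j : nz j -> j \in [seq j <- s | `[< nz j >]].
  move=> nzj; rewrite mem_filter; apply/andP; split; first exact: asboolT.
  by have [m jm nm] := nzj; apply: contrapT => /negP js; apply: nm; exact: sP jm.
have [|d ds dP] := @seq_max [seq j <- s | `[< nz j >]].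
  apply/eqP => s0; apply: nm0; have [t ->] := gcomp_sum m0.
  rewrite big1 // => j _; apply: contrapT => nj.
  have : j \in [seq j <- s | `[< nz j >]].
    by apply: nzs; exists (gcomp j m0) => //; exact: gcomp_deg.
  by rewrite s0.
exists d; split; last first.
  by move: ds; rewrite mem_filter => /andP[/asboolW].
move=> j m dj jm; apply: contrapT => nm.
have /dP : j \in [seq j <- s | `[< nz j >]] by apply: nzs; exists m.
by rewrite leNgt dj.
Qed.

(** Take for b the component of a in degree d - i.  This makes both constructions
    of submodules from top components graded; b has to be the same for all M, as
    the second construction compares two modules. *)
Lemma gcomp_act_gcomp d i (a : A) : exists b, forall M (m : M),
  gcomp d (a *: gcomp i m) = gcomp d (b *: m).
Proof.
have [s [f [fA ->]]] := grading_span (galg_grading gA) a.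
exists (\sum_(j <- s | j + i == d) f j) => M m.
rewrite !scaler_suml !raddf_sum [RHS]big_mkcond; apply: eq_bigr => j _ /=.
have jf : alg_deg A_ j (f j) by exact: fA.
have ji := gmod_act jf (gcomp_deg i m).
case: eqP => [<-|/eqP ne]; first by rewrite gcomp_id // gcomp_act.
by rewrite (gcomp_neq ji) // eq_sym.
Qed.

Section Triangular.
Variables (Am T Ap : {aspace A}).
Hypothesis tri : triangular_decomposition A_ Am T Ap.
Let T1 := tri_one tri.

Lemma tri_T_deg0 (t : subvs_of T) : sub_deg A_ 0 t.
Proof. exact: (subvP (tri_degT tri)) (subvsP t). Qed.

Lemma tri_T_act (t : subvs_of T) M i (m : M) : gmod_deg i m -> gmod_deg i (vsval t *: m).
Proof.
move=> im; rewrite -[i]add0r.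
apply: (@gmod_act _ (alg_deg A_)) im; exact: tri_T_deg0.
Qed.

(** Of the components of z, those in positive degrees raise m above the top degree,
    those in negative degrees vanish, and the one in degree 0 is a scalar. *)
Lemma plus_act_top (z : A) : z \in Ap -> exists k : K,
  forall d M, vanishes_above d M -> forall m : M, gmod_deg d m -> z *: m = k%:A *: m.
Proof.
have [_ /[apply] -[s [f [fP ->]]]] := tri_subp tri.
elim: s => [|i s [k IH]].
  by exists 0 => d M _ m _; rewrite big_nil !scale0r.
suff [k' H] : exists k' : K, forall d M, vanishes_above d M ->
    forall m : M, gmod_deg d m -> f i *: m = k'%:A *: m.
  exists (k' + k) => d M Md m dm.
  by rewrite big_cons scalerDl (H d) // (IH d) // -scalerDl -scalerDl.
have fi := fP i; have [i0|i0|i0] := ltgtP i 0.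
- move: fi; rewrite (tri_degp tri i0) memv0 => /eqP ->.
  by exists 0 => d M _ m _; rewrite !scale0r.
- exists 0 => d M Md m dm; rewrite scale0r scale0r; apply: (Md (i + d)).
    by rewrite ltrDr.
  by apply: gmod_act => //; move: fi; rewrite memv_cap => /andP[].
- move: fi; rewrite i0 (tri_conp tri) => /vlineP[k' ->].
  by exists k'.
Qed.

(** All the components of x but the one in degree 0, a scalar, move m out of
    degree d. *)
Lemma minus_act_top (x : A) : x \in Am -> exists k : K,
  forall d M (m : M), gmod_deg d m -> gcomp d (x *: m) = k%:A *: m.
Proof.
have [_ /[apply] -[s [f [fP ->]]]] := tri_subm tri.
elim: s => [|i s [k IH]].
  by exists 0 => d M m _; rewrite big_nil !scale0r raddf0.
suff [k' H] : exists k' : K, forall d M (m : M), gmod_deg d m ->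
    gcomp d (f i *: m) = k'%:A *: m.
  exists (k' + k) => d M m dm.
  by rewrite big_cons scalerDl raddfD /= H // IH // -scalerDl -scalerDl.
have fi := fP i; have [i0|i0] := eqVneq i 0.
  move: fi; rewrite i0 (tri_conm tri) => /vlineP[k' ->].
  by exists k' => d M m dm; rewrite gcompZ gcomp_id.
exists 0 => d M m dm; rewrite scale0r scale0r.
have Ai : alg_deg A_ i (f i) by move: fi; rewrite memv_cap => /andP[].
by rewrite (gcomp_neq (gmod_act Ai dm)) // -subr_eq0 opprD addrCA subrr addr0 oppr_eq0.
Qed.

(** A product x y z with factors in A^-, T, A^+ acts as a scalar multiple of y, and
    such products span A.  The choice of t does not depend on M, so that the same
    t serves two modules at once in [N_top] below. *)
Lemma top_act (a : A) : exists t : subvs_of T, forall d M, vanishes_above d M ->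
  forall m : M, gmod_deg d m -> gcomp d (a *: m) = vsval t *: m.
Proof.
pose good a := exists t : subvs_of T, forall d M, vanishes_above d M ->
  forall m : M, gmod_deg d m -> gcomp d (a *: m) = vsval t *: m.
rewrite -/(good a).
have good_sum (I : Type) (r : seq I) (F : I -> A) :
    (forall i, good (F i)) -> good (\sum_(i <- r) F i).
  move=> gF; elim: r => [|i r [t IH]].
    by exists 0 => d M _ m _; rewrite big_nil linear0 !scale0r raddf0.
  have [t' H] := gF i; exists (t' + t) => d M Md m dm.
  by rewrite big_cons scalerDl raddfD /= H // IH // -scalerDl -raddfD.
have goodZ k b : good b -> good (k *: b).
  move=> [t H]; exists (k *: t) => d M Md m dm.
  rewrite -[k *: b]mul1r -scalerAr scalerAl -scalerA gcompZ H //.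
  by rewrite scalerA linearZ /= -scalerAl mul1r.
have good_prod (x : subvs_of Am) (y : subvs_of T) (z : subvs_of Ap) :
    good (vsval x * vsval y * vsval z).
  have [k Hx] := minus_act_top (subvsP x); have [k' Hz] := plus_act_top (subvsP z).
  exists ((k * k') *: y) => d M Md m dm.
  rewrite -!scalerA (Hz d M Md m dm) Hx; last by apply/tri_T_act/gmod_degZ.
  rewrite linearZ /= !scalerA; congr (_ *: _).
  by rewrite -!scalerAl !mul1r -scalerAr mulr1 scalerA.
have [g _ gK] := tri_mult tri; rewrite -(gK a) /triple_mult /tensor_lift.
apply: (good_sum) => i; apply: (good_sum) => j; apply: (goodZ).
rewrite mulr_suml; apply: (good_sum) => k; rewrite mulr_suml; apply: (good_sum) => l.
by rewrite -scalerAl; apply: (goodZ).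
Qed.

(** For a T-submodule P of L_d, the set N below is the largest graded A-submodule
    whose top component is in P; by [top_act] it contains P. *)
Lemma simple_top d L : gsimple L -> vanishes_above d L ->
  (exists2 m : L, gmod_deg d m & m <> 0) ->
  simple_submod (@gmod_deg _ _ (res_gmod T1 L) d).
Proof.
move=> [_ sL] Ld [m0 dm0 nm0]; split; first exact: submod_deg tri_T_deg0.
  by exists m0.
move=> P sP Pd; pose N (m : L) := forall a : A, P (gcomp d (a *: m)).
have gN : graded_submod N.
  split; last by move=> i m Nm a; have [b ->] := gcomp_act_gcomp d i a; exact: Nm.
  split=> [a|b x y Nx Ny a]; first by rewrite scaler0 raddf0; exact: (submod0 sP).
  by rewrite scalerDr scalerA raddfD; exact: (submodD sP (Nx _) (Ny _)).
have [P0|nP0] := pselect (forall x, P x -> x = 0); [by left|right].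
have [x Px nx] : exists2 x, P x & x <> 0.
  apply: contrapT => nP; apply: nP0 => x Px.
  by apply: contrapT => nx; apply: nP; exists x.
have Nx : N x.
  move=> a; have [t ta] := top_act a; rewrite (ta _ _ Ld _ (Pd _ Px)).
  exact: (submodZ sP t Px).
have [N0|NL] := sL N gN; first by case: nx; exact: N0.
move=> m dm; have := NL m 1; rewrite scale1r gcomp_id //; exact.
Qed.

Section TopIso.
Variables (d : int) (L L' : gmod (alg_deg A_)).
Hypotheses (sL : gsimple L) (sL' : gsimple L').
Hypotheses (Ld : vanishes_above d L) (Ld' : vanishes_above d L').
Hypothesis nzL : exists2 m : L, gmod_deg d m & m <> 0.
Variable r : res T1 L -> res T1 L' -> Prop.
Hypothesis ir : iso_factor (fun x => x = 0) (@gmod_deg _ _ (res_gmod T1 L) d)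
  (@gmod_deg _ _ (res_gmod T1 L') d) r.

(** The largest graded A-submodule of L x L' that meets degree d inside the given
    correspondence r of L_d with L'_d. *)
Let N (x : L) (x' : L') : Prop := forall a, r (gcomp d (a *: x)) (gcomp d (a *: x')).

Let N_lin : linrel N.
Proof.
split=> [a|b x y x' y' Nx Ny a].
  by rewrite !scaler0 !raddf0; exact: (isof_lin ir).1.
rewrite !scalerDr !scalerA !raddfD.
have := (isof_lin ir).2 1 _ _ _ _ (Nx (a * b)) (Ny a).
by rewrite !scale1r.
Qed.

Let N_graded i x x' : N x x' -> N (gcomp i x) (gcomp i x').
Proof. by move=> Nx a; have [b bP] := gcomp_act_gcomp d i a; rewrite !bP. Qed.

Let N_top x x' : gmod_deg d x -> gmod_deg d x' -> r x x' -> N x x'.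
Proof.
move=> dx dx' rx a; have [t ta] := top_act a.
rewrite (ta _ _ Ld _ dx) (ta _ _ Ld' _ dx').
have := (isof_lin ir).2 t _ _ _ _ rx (isof_lin ir).1.
by rewrite !addr0.
Qed.

Let nz_pair : exists x x', [/\ gmod_deg d x, gmod_deg d x', x <> 0, x' <> 0 & r x x'].
Proof.
have [x dx nx] := nzL; have [x' rx] := (isof_dom ir x).1 dx.
exists x, x'; split=> //; first by apply/(isof_img ir); exists x.
by move=> x0; apply: nx; apply/(isof_ker ir); rewrite -x0.
Qed.

Let N_ker x : N x 0 -> x = 0.
Proof.
have gP : graded_submod (fun x => N x 0).
  split; last by move=> i m /(N_graded i); rewrite raddf0.
  split=> [|a y z Ny Nz]; first exact: N_lin.1.
  by have := N_lin.2 a _ _ _ _ Ny Nz; rewrite scaler0 addr0.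
have [P0|PL] := sL.2 _ gP; first exact: P0.
have [y [y' [dy _ ny _ _]]] := nz_pair.
have := PL y 1; rewrite !scale1r raddf0 gcomp_id // => r0.
by case: ny; apply/(isof_ker ir).
Qed.

Let N_fun x' : N 0 x' -> x' = 0.
Proof.
have gP : graded_submod (fun x' => N 0 x').
  split; last by move=> i m /(N_graded i); rewrite raddf0.
  split=> [|a y z Ny Nz]; first exact: N_lin.1.
  by have := N_lin.2 a _ _ _ _ Ny Nz; rewrite scaler0 addr0.
have [P0|PL] := sL'.2 _ gP; first exact: P0.
have [y [y' [_ dy' _ ny' _]]] := nz_pair.
have := PL y' 1; rewrite !scale1r raddf0 gcomp_id // => r0.
by case: ny'; apply: (isof_fun ir).
Qed.

Let N_dom x : exists x', N x x'.
Proof.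
have gP : graded_submod (fun x => exists x', N x x').
  split; last by move=> i m [x' /(N_graded i)]; exists (gcomp i x').
  split=> [|a y z [y' Ny] [z' Nz]]; first by exists 0; exact: N_lin.1.
  by exists (a *: y' + z'); exact: N_lin.2.
have [P0|PL] := sL.2 _ gP; last exact: PL.
have [y [y' [dy dy' ny _ ry]]] := nz_pair.
by case: ny; apply: P0; exists y'; exact: N_top.
Qed.

Let N_img x' : exists x, N x x'.
Proof.
have gP : graded_submod (fun x' => exists x, N x x').
  split; last by move=> i m [x /(N_graded i)]; exists (gcomp i x).
  split=> [|a y' z' [y Ny] [z Nz]]; first by exists 0; exact: N_lin.1.
  by exists (a *: y + z); exact: N_lin.2.
have [P0|PL] := sL'.2 _ gP; last exact: PL.
have [y [y' [dy dy' _ ny' ry]]] := nz_pair.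
by case: ny'; apply: P0; exists y; exact: N_top.
Qed.

Let f (x : L) : L' := projT1 (cid (N_dom x)).
Let fN x : N x (f x). Proof. exact: projT2 (cid (N_dom x)). Qed.

Let N_uniq x x' y' : N x x' -> N x y' -> x' = y'.
Proof.
move=> Nx Ny; apply/eqP; rewrite -subr_eq0; apply/eqP/N_fun.
by have := linrelB N_lin Nx Ny; rewrite subrr.
Qed.

Let f_linear : linear f.
Proof. by move=> a x y; apply: N_uniq (fN _) _; exact: N_lin.2. Qed.

HB.instance Definition _ := GRing.isLinear.Build A L L' _ f f_linear.

Lemma top_iso_k0 : k0_eq [:: (true, L)] [:: (true, L')].
Proof.
apply: (@k0_iso _ _ _ _ (f : {linear L -> L'})).
- move=> i m im; have := N_graded i (fN m); rewrite (gcomp_id im) => H.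
  by rewrite /= (N_uniq (fN m) H); exact: gcomp_deg.
- move=> x y /= fxy; apply/eqP; rewrite -subr_eq0; apply/eqP/N_ker.
  by have := linrelB N_lin (fN x) (fN y); rewrite fxy subrr.
- move=> x'; have [x Nx] := N_img x'; exists x; exact: N_uniq (fN x).
Qed.

End TopIso.

Lemma word_top (w : word (alg_deg A_)) : w <> [::] -> simple_word w ->
  exists d w1 p w2, [/\ w = w1 ++ p :: w2,
    exists2 m : p.2, gmod_deg d m & m <> 0 &
    List.Forall (fun q => vanishes_above d q.2) w].
Proof.
elim: w => // p w IH _ sw; have [sp {}sw] := (List.Forall_cons_iff _ _ _).1 sw.
have [d [pd nzp]] := top_degree sp.1.
have [w0|nw] := pselect (w = [::]).
  exists d, [::], p, [::]; rewrite w0; split=> //.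
  by apply: List.Forall_cons => //; exact: List.Forall_nil.
have [d' [w1 [q [w2 [ew nzq wd']]]]] := IH nw sw.
have [dd'|d'd] := leP d d'.
  exists d', (p :: w1), q, w2; split=> //; first by rewrite ew.
  apply: List.Forall_cons => // j m d'j; apply: pd.
  exact: le_lt_trans d'j.
exists d, [::], p, w; split=> //; apply: List.Forall_cons => //.
apply: List.Forall_impl wd' => q' q'd' j m dj; apply: q'd'.
exact: lt_trans dj.
Qed.

(** Without such an entry all the terms of w would have the sign b, or vanish, and
    could not compensate for the first one. *)
Lemma opposite_term (X : Type) (F : X -> nat) b x (w : seq (bool * X)) :
  \sum_(p <- (b, x) :: w) (if p.1 then (F p.2)%:Z else - (F p.2)%:Z) = 0 ->
  (0 < F x)%N ->
  exists w1 y w2, w = w1 ++ (~~ b, y) :: w2 /\ (0 < F y)%N.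
Proof.
rewrite big_cons /= => sum0 Fx; apply: contrapT => nopp.
move es : (\sum_(p <- w) _) sum0 => s sum0; suff : if b then 0 <= s else s <= 0.
  case: b sum0 {nopp es} => /eqP; rewrite addrC addr_eq0 => /eqP ->.
    by rewrite oppr_ge0 lez_nat leqNgt Fx.
  by rewrite opprK lez_nat leqNgt Fx.
rewrite -{s sum0}es; elim: w nopp => [|[c y] w IH] nopp.
  by rewrite big_nil; case: (b).
have : if b then 0 <= \sum_(p <- w) (if p.1 then (F p.2)%:Z else - (F p.2)%:Z)
    else \sum_(p <- w) (if p.1 then (F p.2)%:Z else - (F p.2)%:Z) <= 0.
  apply: IH => -[w1 [z [w2 [ew Fz]]]]; apply: nopp.
  by exists ((c, y) :: w1), z, w2; rewrite ew.
have Fy : c = ~~ b -> F y = 0%N.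
  move=> cb; apply/eqP; rewrite -leqn0 leqNgt; apply/negP => Fy; apply: nopp.
  by exists [::], y, w; rewrite cb.
rewrite big_cons /=; case: b c Fy {IH nopp} => [] [] Fy ws.
- exact: addr_ge0.
- by rewrite Fy // oppr0 add0r.
- by rewrite Fy // add0r.
- by rewrite -oppr_ge0 opprD opprK addr_ge0 ?oppr_ge0.
Qed.

(** An entry L of largest top degree cancels against an isomorphic one of opposite
    sign, detected by the multiplicity of L_d in degree d. *)
Lemma simple_word_inj (w : word (alg_deg A_)) :
  simple_word w -> k0_eq (res_word T1 w) [::] -> k0_eq w [::].
Proof.
(* The induction is on the size: cancelling removes two entries at once. *)
have [n] := ubnP (size w); elim: n w => // n IH w; rewrite ltnS => sz sw w0.
have [->|nw] := pselect (w = [::]); first exact: k0_refl.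
have [d [w1 [[b L] [w2 [ew nzL wd]]]]] := word_top nw sw.
have ewp := k0_move (b, L) w1 w2; rewrite -ew in ewp.
rewrite ew in sw wd; move: sw wd => /List.Forall_app[sw1 /List.Forall_cons_iff[sL sw2]].
move=> /List.Forall_app[wd1 /List.Forall_cons_iff[Ld wd2]].
have sw' : simple_word (w1 ++ w2) by apply/simple_word_cat.
have wd' : List.Forall (fun q => vanishes_above d q.2) (w1 ++ w2).
  exact/List.Forall_app.
have sz' : (size (w1 ++ w2) < n)%N.
  by apply: leq_trans sz; rewrite ew !size_cat addnS.
move: (w1 ++ w2) ewp sw' wd' sz' => w' {ew w1 w2 sw1 sw2 wd1 wd2} ewp sw' wd' sz'.
have sU := simple_top sL Ld nzL.
pose mu (M : gmod (alg_deg A_)) := mult tri_T_deg0 sU d (res_gmod T1 M).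
have mu_sum : \sum_(p <- (b, L) :: w') (if p.1 then (mu p.2)%:Z else - (mu p.2)%:Z) = 0.
  have /= e := k0_trans (k0_sym (res_k0_eq T1 ewp)) w0.
  have := word_mult_k0 tri_T_deg0 sU d e.
  by rewrite /word_mult [RHS]big_nil !big_cons big_map.
have muL : (0 < mu L)%N.
  apply: (@mult_max _ _ _ tri_T_deg0 _ _ sU d (res_gmod T1 L) 1).
  apply: (@chain_step _ _ _ 0 (fun x => x = 0)).
  - exact: chain_nil.
  - exact: ssub_submod sU.
  - by move=> x ->; exact: submod0 (ssub_submod sU).
  - exact/factor_self/(ssub_submod sU).
have [v1 [M [v2 [ew' muM]]]] := opposite_term mu_sum muL.
move: sw' wd'; rewrite ew' => /List.Forall_app[sv1 /List.Forall_cons_iff[sM sv2]].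
move=> /List.Forall_app[_ /List.Forall_cons_iff[Md _]].
have cM := mult_chain tri_T_deg0 sU d (res_gmod T1 M); rewrite -/(mu M) in cM.
have nzM : exists2 m : M, gmod_deg d m & m <> 0.
  apply: contrapT => nM; move: muM; rewrite (chain_zero sU cM) // => m dm.
  by apply: contrapT => nm; apply: nM; exists m.
have [mu1 muf] := chain_simple sU (simple_top sM Md nzM) cM.
have [r ir] : factor (@gmod_deg _ _ (res_gmod T1 L) d) (fun x => x = 0)
    (@gmod_deg _ _ (res_gmod T1 M) d).
  by apply: muf; apply/eqP; rewrite eqn_leq mu1.
have ML := top_iso_k0 sM sL Md Ld nzM ir.
have ev : k0_eq w (v1 ++ v2).
  apply: k0_trans ewp _; rewrite ew'.
  apply: k0_trans (k0_cons _ (k0_move _ _ _)) _.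
  apply: k0_trans (k0_cancel b L _); apply: k0_cons.
  exact: k0_cat (k0_swap_sign _ ML) (k0_refl _).
apply: k0_trans (ev) _; apply: IH.
- by apply: leq_ltn_trans sz'; rewrite ew' !size_cat leq_add2l.
- exact/simple_word_cat.
- exact: k0_trans (k0_sym (res_k0_eq T1 ev)) w0.
Qed.

End Triangular.
End TopDegree.

Theorem proposition3p19 (K : fieldType) (A : falgType K)
    (A_ : int -> {vspace A}) (Am T Ap : {aspace A})
    (gradA : graded_algebra A_)
    (tri : triangular_decomposition A_ Am T Ap) :
  injective (chi A_ (tri_one tri)).
Proof.
move=> x y; rewrite -(k0_reprK x) -(k0_reprK y) !chi_of => /k0_ofP exy.
apply/k0_ofP/k0_subr_eq; set w := _ ++ _.
have [v [sv ewv]] := word_k0_simple w.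
apply: k0_trans (ewv) _; apply: (simple_word_inj gradA (tri := tri)) => //.
apply: k0_trans (k0_sym (res_k0_eq (tri_one tri) ewv)) _.
rewrite /w /res_word map_cat.
have -> : [seq (p.1, res_gmod (tri_one tri) p.2) | p <- flip (k0_repr y)]
    = flip (res_word (tri_one tri) (k0_repr y)) by rewrite /flip -!map_comp.
exact: k0_trans (k0_cat exy (k0_refl _)) (k0_eq_flip _).
Qed.
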